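(* Fix $m\ge 2$. The receiver's optimal payoff over all protocols with $m$ memory states is \[ \sup_{\Pi} U^{R}(\Pi)= \begin{cases} 1-\dfrac{2\sqrt{p(1-p)\gamma^{m-2}}-1}{\gamma^{m-2}-1}, & \text{if } \gamma^{m-2}>\kappa,\\[1em] \max\{p,1-p\}, & \text{otherwise.} \end{cases} \] Furthermore, if $m\ge 4$ and $\gamma^{m-2}>\kappa$, there is no protocol $\Pi^*$ with $m$ memory states such that $U^R(\Pi^* )=\sup_{\Pi}U^R(\Pi)$.
   Context: Setting. The state of nature is $\theta\in\Theta=\{H,L\}$ with prior $\Pr(\theta=H)=p\in(0,1)$. A sender privately observes $\theta$; a receiver does not. $S$ is a finite signal set; conditional on $\theta$, signals are i.i.d. with distribution $\pi_\theta$ on $S$, where $\pi_\theta(s)>0$ for all $s\in S,\theta\in\Theta$, and $\pi_H\neq\pi_L$. The receiver has the set of memory states $M=\{1,\dots,m\}$ and chooses a protocol $\Pi=(f,g,a)$: a transition function $f:M\times S\to\Delta(M)$ ($f(i,s)(j)$ is the probability of moving from memory state $i$ to $j$ after signal $s$), an initial distribution $g\in\Delta(M)$ of $m_0$, and an action rule $a:M\to[0,1]$ (probability of action $H$ if the game ends in that memory state). A sender strategy is $\sigma:M\times\Theta\to[0,1]$, the probability of stopping in the current memory state given $\theta$. Timing: $m_0\sim g$; in each period $t=0,1,\dots$, with current memory state $m_t$, the game ends if $m_t$ is absorbing ($f(m_t,s)(m_t)=1$ for all $s$); otherwise the sender stops with probability $\sigma(m_t,\theta)$, ending the game; if not stopped,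 a signal $s_t\sim\pi_\theta$ is generated and $m_{t+1}\sim f(m_t,s_t)$. When the game ends in state $m_t$ the receiver takes action $H$ with probability $a(m_t)$ and $L$ otherwise. The receiver's payoff is $1$ if the action equals $\theta$ and $0$ otherwise; the sender's payoff is $1$ if the action is $H$ and $0$ otherwise; there is no discounting; if the game never ends both get $0$. $U^S(\Pi,\sigma),U^R(\Pi,\sigma)$ denote expected payoffs, $\mathrm{br}(\Pi)=\arg\sup_\sigma U^S(\Pi,\sigma)$ is the set of sender best responses, and $U^R(\Pi):=U^R(\Pi,\sigma)$, $U^S(\Pi):=U^S(\Pi,\sigma)$ for $\sigma\in\mathrm{br}(\Pi)$ (these do not depend on the choice of best response when the game ends with probability one). The supremum $\sup_\Pi$ is over all protocols on $M$. Signal informativeness: $\bar\ell=\max_{s\in S}\pi_H(s)/\pi_L(s)$, $\underline\ell=\min_{s\in S}\pi_H(s)/\pi_L(s)$, $\gamma=\bar\ell/\underline\ell\in(1,\infty)$. Prior skewness: $\kappa=\max\{p/(1-p),(1-p)/p\}$. *)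

(* Defs.v *)
From mathcomp Require Import all_boot all_order all_algebra.
From mathcomp Require Import all_classical all_reals all_analysis.
Set Implicit Arguments. Unset Strict Implicit. Unset Printing Implicit Defensive.
Import Order.TTheory GRing.Theory Num.Theory.
Import numFieldNormedType.Exports.
Local Open Scope classical_set_scope.
Local Open Scope ring_scope.

Section Game.
Variable R : realType.
Variable S : finType.
Variable p : R.
Variable pi : bool -> S -> R.  (* pi true = pi_H, pi false = pi_L *)
Variable m : nat.

Definition is_dist (T : finType) (d : T -> R) :=
  (forall x, 0 <= d x) /\ \sum_(x : T) d x = 1.

Definition lratio (s : S) : R := pi true s / pi false s.
Definition lbar : R := \big[Num.max/0]_(s : S) lratio s.
(* minimum of the ratios (all ratios are <= lbar, so lbar is a neutral seed) *)
Definition lunder : R := \big[Num.min/lbar]_(s : S) lratio s.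
Definition gamma : R := lbar / lunder.
Definition kappa : R := Num.max (p / (1 - p)) ((1 - p) / p).

(* A protocol (f, g, a): f i s j = prob of moving from i to j after s;
   g = initial distribution; a i = prob of action H when the game ends in i.
   A sender strategy sigma i theta = prob of stopping in i given theta. *)
Definition valid_protocol (f : 'I_m -> S -> 'I_m -> R) (g : 'I_m -> R)
  (a : 'I_m -> R) :=
  (forall i s, is_dist (f i s)) /\ is_dist g /\ (forall i, 0 <= a i <= 1).

Definition valid_strategy (sigma : 'I_m -> bool -> R) :=
  forall i th, 0 <= sigma i th <= 1.

Definition absorbing (f : 'I_m -> S -> 'I_m -> R) (i : 'I_m) : bool :=
  [forall s, f i s i == 1].

(* probability that the game ends in state i, given it is in state i at
   the start of a period (before the stopping decision) *)
Definition stopw f (sigma : 'I_m -> bool -> R) (th : bool) (i : 'I_m) : R :=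
  if absorbing f i then 1 else sigma i th.

(* occ t j = probability that the game is still running at the start of
   period t and m_t = j, given theta = th *)
Fixpoint occ f (g : 'I_m -> R) sigma (th : bool) (t : nat) : 'I_m -> R :=
  match t with
  | 0 => g
  | t'.+1 => fun j => \sum_(i : 'I_m)
      occ f g sigma th t' i * (1 - stopw f sigma th i)
        * \sum_(s : S) pi th s * f i s j
  end.

Definition endprob f g sigma th (i : 'I_m) : R :=
  limn (series (fun t => occ f g sigma th t i * stopw f sigma th i)).

Definition prior (th : bool) : R := if th then p else 1 - p.

Definition US f g (a : 'I_m -> R) sigma : R :=
  \sum_(th : bool) prior th * \sum_(i : 'I_m) endprob f g sigma th i * a i.

Definition UR f g (a : 'I_m -> R) sigma : R :=
  \sum_(th : bool) prior th *
    \sum_(i : 'I_m) endprob f g sigma th i * (if th then a i else 1 - a i).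

Definition best_response f g a sigma :=
  valid_strategy sigma /\
  forall sigma', valid_strategy sigma' -> US f g a sigma' <= US f g a sigma.

Definition receiver_values : set R :=
  [set u | exists f g a sigma, valid_protocol f g a /\
     best_response f g a sigma /\ u = UR f g a sigma].

Definition optimal_receiver_payoff : R := sup receiver_values.

End Game.

(* Main.v *)
Require Import Defs.
From mathcomp Require Import all_boot all_order all_algebra.
From mathcomp Require Import all_classical all_reals all_analysis.
From mathcomp Require Import ring lra.
Set Implicit Arguments. Unset Strict Implicit. Unset Printing Implicit Defensive.
Import Order.TTheory GRing.Theory Num.Theory.
Import numFieldNormedType.Exports.
Local Open Scope ring_scope.

(* Write G = gamma ^ (m - 2), and let X and Y be the values of the optimal stopping
   problems of the two types of sender, so that the receiver gets at most
   p X + (1 - p)(1 - Y).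

   Let D be the set where the value function of type H equals the action
   probability. If D is a singleton, both types get the same payoff by stopping
   there. Otherwise there are at most m - 2 other states. Type L may imitate type H
   and stop on D, and the transition kernels of the two types then differ in at most
   m - 2 rows. Replacing one row of the kernel by the other type's row changes the
   odds of success by a factor at most gamma, so
   X / (1 - X) <= G * Y / (1 - Y), and the upper bound is the AM-GM inequality.

   If the odds bound is attained, then for every state i outside D, the state i is
   hit surely before D. Hence only one state outside D leads directly to D, the
   success probability is constant outside D, and replacing any other row changes
   nothing: there is at most one row, that is m <= 3.

   The bound is approached by a ladder whose bottom rung leads to action H with
   probability about eps ^ (m - 2) and on which only m - 2 successive low signals,
   each followed with probability eps, lead to action L. *)

(** * Dirichlet problems of finite Markov chains *)

Section Chains.
Variables (R : realType) (n : nat).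
Implicit Types (P Q : 'I_n -> 'I_n -> R) (D C : {set 'I_n}) (h u b c g : 'I_n -> R).

Definition stochastic P := forall i, is_dist (P i).

(* Combinatorial form of: from every state, the chain reaches D. *)
Definition hits P D := forall C,
  (forall i, i \in C -> i \notin D /\ forall j, P i j != 0 -> j \in C) -> C = finset.set0.

(** [b] is the payoff on the stopping set and [c] a running reward: [c = 0] gives success
    probabilities, [c = 1] expected durations. *)
Definition dirichlet P D b c h :=
  (forall i, i \in D -> h i = b i) /\
  (forall i, i \notin D -> h i = \sum_j P i j * h j + c i).

Lemma hitsS P D D' : D \subset D' -> hits P D -> hits P D'.
Proof.
move=> /fintype.subsetP sDD' hD C hC; apply: hD => i /hC[iD' hj]; split=> //.
by apply: contra iD'; apply: sDD'.
Qed.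

Lemma eq_support_hits P Q D :
  (forall i j, i \notin D -> P i j != 0 -> Q i j != 0) -> hits P D -> hits Q D.
Proof.
move=> PQ hP C hC; apply: hP => i /hC[iD hj]; split=> // j Pij.
by apply: hj; exact: PQ.
Qed.

Lemma avg_subr g h (x : R) : is_dist g ->
  \sum_j g j * (h j - x) = \sum_j g j * h j - x.
Proof.
move=> [_ g1]; under eq_bigr do rewrite mulrBr.
by rewrite sumrB -mulr_suml g1 mul1r.
Qed.

Lemma avg_eq_min g h (x : R) : is_dist g -> (forall j, x <= h j) ->
  \sum_j g j * h j <= x -> forall j, g j != 0 -> h j = x.
Proof.
move=> dg hx hle j gj; have g0 := dg.1.
have s0 : \sum_k g k * (h k - x) == 0.
  rewrite eq_le avg_subr // subr_le0 hle /= -avg_subr //.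
  by apply: sumr_ge0 => k _; rewrite mulr_ge0 ?subr_ge0.
move: s0; rewrite psumr_eq0 => [/allP/(_ j)|k _]; last by rewrite mulr_ge0 ?subr_ge0.
by rewrite mem_index_enum => /(_ isT); rewrite mulf_eq0 (negbTE gj) subr_eq0 => /eqP.
Qed.

(** If the minimum of [u] were negative, its minimisers would lie off [D] and be closed under
    transitions, because an average that is at most the minimum charges only minimisers. This
    contradicts [hits]. *)
Lemma minimum_principle P D u : stochastic P -> hits P D ->
  (forall i, i \in D -> 0 <= u i) ->
  (forall i, i \notin D -> \sum_j P i j * u j <= u i) ->
  forall i, 0 <= u i.
Proof.
move=> sP hP uD uP i; rewrite leNgt; apply/negP => ui0.
have [k _ kmin] := @arg_minP _ _ _ i xpredT u isT.
have uk0 : u k < 0 by apply: le_lt_trans ui0; exact: kmin.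
have : [set j | u j == u k] = finset.set0.
  apply: hP => j; rewrite inE => /eqP ujk.
  have jD : j \notin D by apply/negP => /uD; rewrite ujk leNgt uk0.
  split=> // l Pjl; rewrite inE; apply/eqP.
  apply: (avg_eq_min (sP j)) => //; first by move=> l'; exact: kmin.
  by rewrite -ujk; exact: uP.
by move/setP/(_ k); rewrite !inE eqxx.
Qed.

Lemma dirichlet_le P D b c h u : stochastic P -> hits P D ->
  dirichlet P D b c h ->
  (forall i, i \in D -> b i <= u i) ->
  (forall i, i \notin D -> \sum_j P i j * u j + c i <= u i) ->
  forall i, h i <= u i.
Proof.
move=> sP hP [hD hc] uD uc i; rewrite -subr_ge0.
apply: (@minimum_principle P D (fun i => u i - h i)) => // j jD.
  by rewrite subr_ge0 hD ?uD.
under eq_bigr do rewrite mulrBr.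
by rewrite sumrB; have := uc j jD; have := hc j jD; lra.
Qed.

Lemma dirichlet_ge P D b c h u : stochastic P -> hits P D ->
  dirichlet P D b c h ->
  (forall i, i \in D -> u i <= b i) ->
  (forall i, i \notin D -> u i <= \sum_j P i j * u j + c i) ->
  forall i, u i <= h i.
Proof.
move=> sP hP [hD hc] uD uc i; rewrite -subr_ge0.
apply: (@minimum_principle P D (fun i => h i - u i)) => // j jD.
  by rewrite subr_ge0 hD ?uD.
under eq_bigr do rewrite mulrBr.
by rewrite sumrB; have := uc j jD; have := hc j jD; lra.
Qed.

Lemma dirichlet_unique P D b c h u : stochastic P -> hits P D ->
  dirichlet P D b c h -> dirichlet P D b c u -> h =1 u.
Proof.
move=> sP hP dh [uD uc] i; apply/eqP; rewrite eq_le; apply/andP; split.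
  apply: (dirichlet_le sP hP dh) => j jD; first by rewrite uD.
  by rewrite -uc.
apply: (dirichlet_ge sP hP dh) => j jD; first by rewrite uD.
by rewrite -uc.
Qed.

(* By the minimum principle the linear system has trivial kernel. *)
Lemma dirichlet_exists P D b c : stochastic P -> hits P D ->
  exists h, dirichlet P D b c h.
Proof.
move=> sP hP.
(* The unknown is a row vector, so column [i] of [A] carries the equation of state [i]. *)
pose A : 'M[R]_n := \matrix_(j, i) (if i \in D then (i == j)%:R else (i == j)%:R - P i j).
have AE (v : 'rV[R]_n) i : (v *m A) 0 i =
    if i \in D then v 0 i else v 0 i - \sum_j P i j * v 0 j.
  rewrite mxE; have d1 : \sum_j v 0 j * (i == j)%:R = v 0 i.
    rewrite (bigD1 i) //= eqxx mulr1 big1 ?addr0 // => j ji.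
    by rewrite eq_sym (negbTE ji) mulr0.
  case: ifP => iD.
    by rewrite -[RHS]d1; apply: eq_bigr => j _; rewrite mxE iD.
  rewrite -[in RHS]d1 -sumrB; apply: eq_bigr => j _; rewrite mxE iD.
  by rewrite mulrBr [P i j * _]mulrC.
have Au : A \in unitmx.
  rewrite -row_free_unit; apply: inj_row_free => v vA.
  have d0 : dirichlet P D (fun=> 0) (fun=> 0) (fun i => v 0 i).
    by split=> i iD; have := AE v i; rewrite vA mxE ?iD ?(negbTE iD); lra.
  have dz : dirichlet P D (fun=> 0) (fun=> 0) (fun i => 0).
    split=> // i _; rewrite big1 ?addr0 // => j _; exact: mulr0.
  by apply/rowP => i; rewrite mxE (dirichlet_unique sP hP d0 dz).
pose v := (\row_i (if i \in D then b i else c i)) *m invmx A.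
exists (fun i => v 0 i).
have E i : (v *m A) 0 i = if i \in D then b i else c i.
  by rewrite mulmxKV // mxE.
by split=> i iD; have := E i; rewrite AE ?iD ?(negbTE iD); lra.
Qed.

Lemma dirichlet_compl P D b h : stochastic P ->
  dirichlet P D b (fun=> 0) h ->
  dirichlet P D (fun i => 1 - b i) (fun=> 0) (fun i => 1 - h i).
Proof.
move=> sP [hD hP]; split=> i iD; first by rewrite hD.
under eq_bigr do rewrite mulrBr mulr1.
by rewrite sumrB (sP i).2 {1}hP //; lra.
Qed.

Lemma dirichlet_ge0 P D b h : stochastic P -> hits P D ->
  dirichlet P D b (fun=> 0) h -> (forall i, 0 <= b i) -> forall i, 0 <= h i.
Proof.
move=> sP hP dh b0 i; apply: (dirichlet_ge (u := fun=> 0) sP hP dh) => // j _.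
by rewrite big1 ?addr0 // => k _; rewrite mulr0.
Qed.

Lemma dirichlet01 P D b h : stochastic P -> hits P D ->
  dirichlet P D b (fun=> 0) h -> (forall i, 0 <= b i <= 1) ->
  forall i, 0 <= h i <= 1.
Proof.
move=> sP hP dh b01 i; apply/andP; split.
  by apply: (dirichlet_ge0 sP hP dh) => j; have /andP[] := b01 j.
rewrite -subr_ge0; apply: (dirichlet_ge0 sP hP (dirichlet_compl sP dh)) => j.
by have := b01 j; lra.
Qed.

Definition average g h := \sum_i g i * h i.

Lemma average01 g h : is_dist g -> (forall i, 0 <= h i <= 1) ->
  0 <= average g h <= 1.
Proof.
move=> [g0 g1] h01; apply/andP; split.
  by apply: sumr_ge0 => i _; rewrite mulr_ge0 //; have /andP[] := h01 i.
rewrite -g1; apply: ler_sum => i _; rewrite ler_piMr //.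
by have /andP[] := h01 i.
Qed.

Lemma average_le g h u : is_dist g -> (forall i, h i <= u i) ->
  average g h <= average g u.
Proof. by move=> [g0 _] hu; apply: ler_sum => i _; rewrite ler_wpM2l. Qed.


Lemma average_cst g (x : R) : is_dist g -> average g (fun=> x) = x.
Proof. by move=> [_ g1]; rewrite /average -mulr_suml g1 mul1r. Qed.

(* [y / (1 - y) <= t * (x / (1 - x))], cleared of denominators. *)
Definition odds_le (t x y : R) := y * (1 - x) <= t * (x * (1 - y)).

(** The two inequalities are multiplied and [y * (1 - y)] is cancelled, so [y = 0] and [y = 1] are
    treated first. *)
Lemma odds_le_trans (s t x y z : R) : 0 <= s -> 0 <= t ->
  0 <= x <= 1 -> 0 <= y <= 1 -> 0 <= z <= 1 ->
  odds_le s x y -> odds_le t y z -> odds_le (t * s) x z.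
Proof.
rewrite /odds_le => s0 t0 /andP[x0 x1] /andP[y0 y1] /andP[z0 z1] xy yz.
have rhs0 : 0 <= t * s * (x * (1 - z)) by rewrite !mulr_ge0 // subr_ge0.
have [y00|y0'] := eqVneq y 0.
  have z00 : z = 0 by move: yz; rewrite y00; lra.
  by move: rhs0; rewrite z00 mul0r.
have [y11|y1'] := eqVneq y 1.
  have -> : x = 1 by move: xy; rewrite y11; lra.
  by rewrite subrr mulr0 !mulr_ge0 // subr_ge0.
have yp : 0 < y by rewrite lt_neqAle eq_sym y0'.
have y1p : 0 < 1 - y by rewrite subr_gt0 lt_neqAle y1'.
rewrite -(ler_pM2r (mulr_gt0 yp y1p)).
have -> : z * (1 - x) * (y * (1 - y)) = (z * (1 - y)) * (y * (1 - x)) by ring.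
have -> : t * s * (x * (1 - z)) * (y * (1 - y)) =
  (t * (y * (1 - z))) * (s * (x * (1 - y))) by ring.
by apply: ler_pM => //; rewrite mulr_ge0 // subr_ge0.
Qed.

(** * Odds of success when one row of the kernel changes *)

Section RowChange.
Variables (P P' : 'I_n -> 'I_n -> R) (D : {set 'I_n}) (i : 'I_n) (l u : R).
Variables (b h h' : 'I_n -> R).
Hypotheses (sP : stochastic P) (sP' : stochastic P').
Hypotheses (hP : hits P D) (hP' : hits P' D) (iD : i \notin D).
Hypothesis PP' : forall k, k != i -> P' k =1 P k.
Hypotheses (l0 : 0 < l) (lu : l <= u).
Hypothesis ratio : forall j, l * P i j <= P' i j <= u * P i j.
Hypothesis b01 : forall j, 0 <= b j <= 1.
Hypothesis dh : dirichlet P D b (fun=> 0) h.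
Hypothesis dh' : dirichlet P' D b (fun=> 0) h'.

(** Away from [i] the two kernels agree, so combinations of [h] and [h'] obey the minimum principle
    with [i] added to the boundary. *)
Let hi_off k : k \notin i |: D ->
  h k = \sum_j P k j * h j /\ h' k = \sum_j P k j * h' j.
Proof.
rewrite !inE negb_or => /andP[ki kD]; split; first by rewrite {1}dh.2 // addr0.
by rewrite {1}dh'.2 // addr0; apply: eq_bigr => j _; rewrite PP'.
Qed.

Let hits_i : hits P (i |: D).
Proof. by apply: hitsS hP; apply: finset.subsetUr. Qed.

Lemma row_change_nonincr : h' i <= h i -> forall j, h' j <= h j.
Proof.
move=> hi j; rewrite -subr_ge0.
apply: (minimum_principle (u := fun k => h k - h' k) sP hits_i) => k kD.
  case: (eqVneq k i) kD => [-> _|ki]; first by rewrite subr_ge0.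
  by rewrite !inE (negbTE ki) /= => kD; rewrite dh.1 // dh'.1 // subrr.
have [-> ->] := hi_off kD.
by under eq_bigr do rewrite mulrBr; rewrite sumrB.
Qed.

(** The expression is harmonic off [i |: D], zero at [i] and a nonnegative multiple of [b] on [D].
    The ratio of [h'] to [h] is thus largest at [i]. *)
Lemma row_change_high : h i < h' i ->
  forall j, 0 <= h' i * h j - h i * h' j.
Proof.
move=> hi; apply: (minimum_principle sP hits_i) => k kD.
  case: (eqVneq k i) kD => [-> _|ki]; first by rewrite mulrC subrr.
  rewrite !inE (negbTE ki) /= => kD; rewrite (dh.1 k) // (dh'.1 k) //.
  by have b01k := b01 k; rewrite /= -mulrBl; apply: mulr_ge0; lra.
have [-> ->] := hi_off kD.
by rewrite !mulr_sumr -sumrB; apply: ler_sum => j _; lra.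
Qed.

(** The same argument for failure: the ratio of [1 - h'] to [1 - h] is smallest at [i]. *)
Lemma row_change_low : h i < h' i ->
  forall j, 0 <= (1 - h i) * (1 - h' j) - (1 - h' i) * (1 - h j).
Proof.
move=> hi; apply: (minimum_principle sP hits_i) => k kD.
  case: (eqVneq k i) kD => [-> _|ki]; first by rewrite mulrC subrr.
  rewrite !inE (negbTE ki) /= => kD; rewrite (dh.1 k) // (dh'.1 k) //.
  by have b01k := b01 k; rewrite /= -mulrBl; apply: mulr_ge0; lra.
have [-> ->] := hi_off kD.
rewrite [leLHS](_ : _ = (1 - h i) * (\sum_j P k j - \sum_j P k j * h' j) -
  (1 - h' i) * (\sum_j P k j - \sum_j P k j * h j)); first by rewrite (sP k).2.
by rewrite -!sumrB !mulr_sumr -sumrB; apply: eq_bigr => j _; ring.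
Qed.

(** The difference of the two sides is the sum of the expressions in [row_change_high] and
    [row_change_low]. *)
Lemma row_change_gap : h i < h' i -> forall j, h' j - h j <= h' i - h i.
Proof.
by move=> hi j; have := row_change_high hi j; have := row_change_low hi j; lra.
Qed.

(** Write x = [h i] and y = [h' i]. Averaging the expressions of [row_change_high] and
    [row_change_low] under rows [i] of [P] and [P'], which are comparable by [ratio], gives y (c -
    x) <= u x (y - a) and l (1 - x) (y - a) <= (1 - y) (c - x). Multiply, and cancel the positive
    factors y - a and c - x. *)
Lemma row_change_odds_at : h i < h' i -> odds_le (u / l) (h i) (h' i).
Proof.
move=> hi; rewrite /odds_le.
pose a := \sum_j P i j * h' j; pose c := \sum_j P' i j * h j.
have hx : h i = \sum_j P i j * h j by rewrite {1}dh.2 // addr0.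
have hy : h' i = \sum_j P' i j * h' j by rewrite {1}dh'.2 // addr0.
have sumA (Q : 'I_n -> R) : \sum_j Q j * (h' i * h j - h i * h' j) =
    h' i * (\sum_j Q j * h j) - h i * (\sum_j Q j * h' j).
  by rewrite !mulr_sumr -sumrB; apply: eq_bigr => j _; ring.
have sumB (Q : 'I_n -> R) : is_dist Q ->
    \sum_j Q j * ((1 - h i) * (1 - h' j) - (1 - h' i) * (1 - h j)) =
    (1 - h i) * (1 - \sum_j Q j * h' j) - (1 - h' i) * (1 - \sum_j Q j * h j).
  move=> [_ Q1]; transitivity ((1 - h i) * (\sum_j Q j - \sum_j Q j * h' j) -
    (1 - h' i) * (\sum_j Q j - \sum_j Q j * h j)); last by rewrite Q1.
  by rewrite -!sumrB !mulr_sumr -sumrB; apply: eq_bigr => j _; ring.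
have A0 := row_change_high hi; have B0 := row_change_low hi.
have hA : \sum_j P' i j * (h' i * h j - h i * h' j) <=
          u * \sum_j P i j * (h' i * h j - h i * h' j).
  rewrite mulr_sumr; apply: ler_sum => j _; rewrite mulrA ler_wpM2r //.
  by have /andP[] := ratio j.
have hB : l * (\sum_j P i j * ((1 - h i) * (1 - h' j) - (1 - h' i) * (1 - h j)))
    <= \sum_j P' i j * ((1 - h i) * (1 - h' j) - (1 - h' i) * (1 - h j)).
  rewrite mulr_sumr; apply: ler_sum => j _; rewrite mulrA ler_wpM2r //.
  by have /andP[] := ratio j.
rewrite !sumA -hx -hy -/a -/c in hA.
rewrite !sumB // -hx -hy -/a -/c in hB.
have /andP[x0 x1] := dirichlet01 sP hP dh b01 i.
have /andP[y0 y1] := dirichlet01 sP' hP' dh' b01 i.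
have ay : a < h' i.
  have : 0 <= \sum_j P i j * ((h' i * h j - h i * h' j) +
      ((1 - h i) * (1 - h' j) - (1 - h' i) * (1 - h j))).
    apply: sumr_ge0 => j _; apply: mulr_ge0; first exact: (sP i).1.
    by apply: addr_ge0.
  under eq_bigr do rewrite mulrDr.
  rewrite big_split /= sumA sumB // -hx -/a => ay.
  rewrite lt_neqAle; apply/andP; split; last by nra.
  (* Otherwise [h' - h] is harmonic everywhere off [D], hence zero. *)
  apply/negP => /eqP ay'.
  have d0 : dirichlet P D (fun=> 0) (fun=> 0) (fun k => h' k - h k).
    split=> k kD; first by rewrite dh.1 // dh'.1 // subrr.
    under eq_bigr do rewrite mulrBr.
    rewrite sumrB addr0; have [->|ki] := eqVneq k i; first by rewrite -hx -/a ay'.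
    have : k \notin i |: D by rewrite !inE negb_or ki.
    by move=> /hi_off[<- <-].
  have dz : dirichlet P D (fun=> 0) (fun=> 0) (fun=> 0).
    by split=> // k _; rewrite big1 ?addr0 // => j _; exact: mulr0.
  by have := dirichlet_unique sP hP d0 dz i; lra.
have cx : h i < c.
  have L : 0 < l * ((1 - h i) * (h' i - a)).
    by rewrite !mulr_gt0 // subr_gt0 // (lt_le_trans hi).
  rewrite ltNge; apply/negP => cx.
  have : (1 - h' i) * (c - h i) <= 0 by rewrite mulr_ge0_le0 ?subr_ge0 ?subr_le0.
  by lra.
rewrite mulrAC ler_pdivlMr // -mulrA.
suff : (h' i * (1 - h i) * l) * ((h' i - a) * (c - h i)) <=
       (u * (h i * (1 - h' i))) * ((h' i - a) * (c - h i)).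
  by rewrite ler_pM2r ?mulr_gt0 ?subr_gt0 //; lra.
have hA' : h' i * (c - h i) <= u * (h i * (h' i - a)) by lra.
have hB' : l * ((1 - h i) * (h' i - a)) <= (1 - h' i) * (c - h i) by lra.
have := ler_pM _ _ hA' hB'.
rewrite !mulr_ge0 ?subr_ge0 ?(ltW l0) ?(ltW ay) ?(ltW cx) // => /(_ isT isT).
by lra.
Qed.

Variable g : 'I_n -> R.
Hypothesis dg : is_dist g.

Let avg_high : h i < h' i -> h i * average g h' <= h' i * average g h.
Proof.
move=> hi; rewrite -subr_ge0 !mulr_sumr -sumrB; apply: sumr_ge0 => j _.
have := mulr_ge0 (dg.1 j) (row_change_high hi j); lra.
Qed.

Let avg_low : h i < h' i ->
  (1 - h' i) * (1 - average g h) <= (1 - h i) * (1 - average g h').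
Proof.
move=> hi; rewrite -subr_ge0 /average -dg.2 -!sumrB !mulr_sumr -sumrB dg.2.
apply: sumr_ge0 => j _.
have := mulr_ge0 (dg.1 j) (row_change_low hi j); lra.
Qed.

Let h01 := average01 dg (dirichlet01 sP hP dh b01).
Let h'01 := average01 dg (dirichlet01 sP' hP' dh' b01).

Let interior : h i < h' i -> 0 < h i /\ h' i < 1.
Proof.
move=> hi; have := row_change_odds_at hi; rewrite /odds_le.
have /andP[x0 x1] := dirichlet01 sP hP dh b01 i.
have /andP[y0 y1] := dirichlet01 sP' hP' dh' b01 i.
move=> odds; split; rewrite lt_neqAle ?x0 ?y1 andbT; apply/eqP => e.
  by move: odds; rewrite -e mul0r mulr0 subr0 mulr1; lra.
by move: odds; rewrite e subrr !mulr0 mul1r; lra.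
Qed.

(** If [h' i <= h i], success becomes no likelier anywhere. Otherwise the product of [avg_high] and
    [avg_low] bounds the odds ratio of the averages by the one at [i]. *)
Lemma row_change_odds : odds_le (u / l) (average g h) (average g h').
Proof.
move: h01 h'01 => /andP[G0 G1] /andP[G'0 G'1].
have t1 : 1 <= u / l by rewrite ler_pdivlMr // mul1r.
have [hi|hi] := ltP (h i) (h' i); last first.
  have := average_le dg (row_change_nonincr hi); rewrite /odds_le => GG'.
  rewrite -[leLHS]mul1r; apply: ler_pM => //; first by rewrite mulr_ge0 // subr_ge0.
  by apply: ler_pM; rewrite ?subr_ge0 // lerB.
have [x0 y1] := interior hi.
have odds := row_change_odds_at hi.
have := ler_pM _ _ (avg_high hi) (avg_low hi).
rewrite !mulr_ge0 ?subr_ge0 ?(ltW x0) ?(ltW y1) // => /(_ isT isT) prod.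
have pos : 0 < h i * (1 - h' i) by rewrite mulr_gt0 // subr_gt0.
rewrite /odds_le -(ler_pM2l pos).
apply: (@le_trans _ _ (h' i * (1 - h i) * (average g h * (1 - average g h')))).
  by lra.
apply: (@le_trans _ _ (u / l * (h i * (1 - h' i)) * (average g h * (1 - average g h')))).
  by rewrite ler_wpM2r ?mulr_ge0 ?subr_ge0.
by lra.
Qed.

(** Equality forces equality in [avg_high] and [avg_low]. Together they make the average of [h' - h]
    under [g] at least its value at [i], which is its maximum, so the maximum is taken on the whole
    support of [g]. *)
Lemma row_change_odds_eq : l < u -> 0 < average g h < 1 -> average g h' < 1 ->
  average g h' * (1 - average g h) = u / l * (average g h * (1 - average g h')) ->
  h i < h' i /\ forall j, g j != 0 -> h' j - h j = h' i - h i.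
Proof.
move=> ltlu /andP[G0 G1] G'1 E.
have t1 : 1 < u / l by rewrite ltr_pdivlMr // mul1r.
have Gp : 0 < average g h * (1 - average g h') by rewrite mulr_gt0 // subr_gt0.
have [hi|hi] := ltP (h i) (h' i); last first.
  have GG' := average_le dg (row_change_nonincr hi).
  have : average g h' * (1 - average g h) <= average g h * (1 - average g h') by lra.
  by rewrite E leNgt -subr_lt0 => /negP[]; nra.
split=> // j gj.
have [x0 y1] := interior hi.
have odds := row_change_odds_at hi; rewrite /odds_le in odds.
have a1 := avg_high hi; have a2 := avg_low hi.
have p1 : 0 < h i by [].
have p2 : 0 < 1 - h' i by rewrite subr_gt0.
have p3 : 0 < 1 - h i by lra.
have p4 : 0 < 1 - average g h by lra.
have p5 : 0 < 1 - average g h' by lra.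
(* The reverse of the product of [a1] and [a2]; cancelling one of them reverses the other. *)
have eqs : (h' i * average g h) * ((1 - h i) * (1 - average g h')) <=
   (h i * average g h') * ((1 - h' i) * (1 - average g h)).
  have -> : h i * average g h' * ((1 - h' i) * (1 - average g h)) =
     h i * (1 - h' i) * (average g h' * (1 - average g h)) by ring.
  rewrite E.
  have -> : h i * (1 - h' i) * (u / l * (average g h * (1 - average g h'))) =
     u / l * (h i * (1 - h' i)) * (average g h * (1 - average g h')) by ring.
  apply: (@le_trans _ _ (h' i * (1 - h i) * (average g h * (1 - average g h')))).
    by lra.
  by rewrite ler_wpM2r // ltW.
have e1 : h' i * average g h <= h i * average g h'.
  have q : 0 < (1 - h' i) * (1 - average g h) by rewrite mulr_gt0.
  rewrite -(ler_pM2r q); apply: le_trans eqs.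
  by rewrite ler_wpM2l // mulr_ge0 // ltW // (lt_trans p1).
have e2 : (1 - h i) * (1 - average g h') <= (1 - h' i) * (1 - average g h).
  have q : 0 < h' i * average g h by rewrite mulr_gt0 // (lt_trans p1).
  by rewrite -(ler_pM2l q); apply: le_trans eqs _; rewrite ler_wpM2r // mulr_ge0 // ltW.
have gap : average g h' - average g h >= h' i - h i by lra.
suff: - (h' j - h j) = - (h' i - h i) by move=> /oppr_inj.
apply: (avg_eq_min (h := fun k => - (h' k - h k)) dg _ _ gj).
  by move=> k; rewrite lerN2; exact: row_change_gap.
under eq_bigr do rewrite mulrN mulrBr.
by rewrite sumrN sumrB lerN2.
Qed.

End RowChange.


(** Off [D] the chain must pass through [i0] before it meets [D]. So the function equal to [h] on
    [D] and to [h i0] elsewhere solves the problem with [i0] added to the boundary, and uniqueness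
    applies. *)
Lemma dirichlet_sole_exit Q D b h i0 : stochastic Q -> hits Q D -> i0 \notin D ->
  dirichlet Q D b (fun=> 0) h ->
  (forall i, i \notin D -> i != i0 -> forall d, d \in D -> Q i d = 0) ->
  forall i, i \notin D -> h i = h i0.
Proof.
move=> sQ hQ i0D [hD hh] exit i iD.
pose v j := if j \in D then h j else h i0.
have dv : dirichlet Q (i0 |: D) h (fun=> 0) v.
  split=> j; rewrite !inE /v.
    by case: eqVneq => [->|_ /= ->] //; rewrite (negbTE i0D).
  rewrite negb_or => /andP[ji jD]; rewrite (negbTE jD) addr0.
  rewrite -[LHS]mul1r -(sQ j).2 mulr_suml; apply: eq_bigr => k _.
  by case: ifP => // kD; rewrite exit // !mul0r.
have dh : dirichlet Q (i0 |: D) h (fun=> 0) h.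
  by split=> // j; rewrite !inE negb_or => /andP[_ jD]; exact: hh.
have hQ' : hits Q (i0 |: D) by apply: hitsS hQ; apply: finset.subsetUr.
by rewrite (dirichlet_unique sQ hQ' dh dv) /v (negbTE iD).
Qed.

(** * Exchange of all rows, and the case of equality *)

Section AllRows.
Variables (P P' : 'I_n -> 'I_n -> R) (D : {set 'I_n}) (l u : R).
Variables (b g : 'I_n -> R).
Hypotheses (sP : stochastic P) (sP' : stochastic P') (hP : hits P D).
Hypotheses (l0 : 0 < l) (lu : l <= u).
Hypothesis ratio : forall i j, l * P i j <= P' i j <= u * P i j.
Hypothesis b01 : forall j, 0 <= b j <= 1.
Hypothesis dg : is_dist g.

Definition hybrid (B : {set 'I_n}) i := if i \in B then P' i else P i.

Let sB B : stochastic (hybrid B).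
Proof. by move=> i; rewrite /hybrid; case: ifP. Qed.

Let hB B : hits (hybrid B) D.
Proof.
apply: eq_support_hits hP => i j _ Pij; rewrite /hybrid; case: ifP => // _.
have Pp : 0 < P i j by rewrite lt_neqAle eq_sym Pij (sP i).1.
by have := mulr_gt0 l0 Pp; have := ratio i j; lra.
Qed.

Let hybrid_ratio (B : {set 'I_n}) i j : i \in B ->
  l * hybrid (B :\ i) i j <= hybrid B i j <= u * hybrid (B :\ i) i j.
Proof. by move=> iB; rewrite /hybrid !inE eqxx iB /=. Qed.

Let hybrid_same (B : {set 'I_n}) i : i \in B ->
  forall k, k != i -> hybrid B k =1 hybrid (B :\ i) k.
Proof. by move=> iB k ki j; rewrite /hybrid !inE ki. Qed.

(** Rows are exchanged one at a time, each at the cost of a factor [u / l]. Every hybrid still hits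
    [D], since [l > 0] keeps the transitions of [P] possible. *)
Lemma all_rows_odds (B : {set 'I_n}) h0 h : [disjoint B & D] ->
  dirichlet P D b (fun=> 0) h0 -> dirichlet (hybrid B) D b (fun=> 0) h ->
  odds_le ((u / l) ^+ #|B|) (average g h0) (average g h).
Proof.
move=> BD dh0; move kB : #|B| => k; elim: k => [|k IHk] in B BD kB h *.
  move/eqP: kB; rewrite cards_eq0 => /eqP -> dh.
  have d0 : dirichlet P D b (fun=> 0) h.
    by split=> i iD; [exact: dh.1|rewrite {1}dh.2 // /hybrid inE].
  rewrite /odds_le expr0 mul1r /average.
  by under eq_bigr do rewrite (dirichlet_unique sP hP d0 dh0).
have [B0|[i iB]] := finset.set_0Vmem B; first by rewrite B0 cards0 in kB.
have kB' : #|B :\ i| = k by move: kB; rewrite (cardsD1 i) iB => -[].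
have BD' : [disjoint B :\ i & D].
  by apply: disjointWl BD; apply: subD1set.
move=> dh; have [h1 dh1] := dirichlet_exists b (fun=> 0) (sB (B :\ i)) (@hB _).
have := IHk _ BD' kB' _ dh1.
have iD : i \notin D by rewrite (disjointFr BD).
have := row_change_odds (sB _) (sB _) (@hB _) (@hB _) iD (hybrid_same iB) l0 lu
  (fun j => hybrid_ratio j iB) b01 dh1 dh dg.
have ul0 : 0 <= u / l by rewrite divr_ge0 ?ltW // (lt_le_trans l0).
move=> o2 o1; rewrite exprS; apply: odds_le_trans o1 o2; rewrite ?exprn_ge0 //.
- exact: average01 (dirichlet01 sP hP dh0 b01).
- exact: average01 (dirichlet01 (sB _) (@hB _) dh1 b01).
- exact: average01 (dirichlet01 (sB _) (@hB _) dh b01).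
Qed.

Let hP' : hits P' D.
Proof.
apply: eq_support_hits (@hB (~: D)) => i j iD.
by rewrite /hybrid inE iD.
Qed.

Let dirichletC h : dirichlet P' D b (fun=> 0) h ->
  dirichlet (hybrid (~: D)) D b (fun=> 0) h.
Proof.
by move=> [hD hh]; split=> // i iD; rewrite {1}hh // /hybrid inE iD.
Qed.

Section Equality.
Variables (h0 h : 'I_n -> R).
Hypothesis ltlu : l < u.
Hypotheses (dh0 : dirichlet P D b (fun=> 0) h0) (dh : dirichlet P' D b (fun=> 0) h).
Hypotheses (X01 : 0 < average g h < 1) (Y01 : 0 < average g h0 < 1).
Hypothesis E : average g h * (1 - average g h0) =
  (u / l) ^+ #|~: D| * (average g h0 * (1 - average g h)).

(* Swapping row [i] last: its step of the chain of odds bounds is an equality. *)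
Let last_row i : i \notin D -> exists h1,
  [/\ dirichlet (hybrid (~: D :\ i)) D b (fun=> 0) h1, h1 i < h i,
      forall j, h j - h1 j <= h i - h1 i &
      forall j, g j != 0 -> h j - h1 j = h i - h1 i].
Proof.
move=> iD; have iB : i \in ~: D by rewrite inE.
have [h1 dh1] := dirichlet_exists b (fun=> 0) (sB (~: D :\ i)) (@hB _).
have dis : [disjoint ~: D :\ i & D].
  by rewrite disjoint_subset; apply/fintype.subsetP => j; rewrite !inE => /andP[].
have o1 := all_rows_odds dis dh0 dh1.
have o2 := row_change_odds (sB _) (sB _) (@hB _) (@hB _) iD (hybrid_same iB) l0 lu
  (fun j => hybrid_ratio j iB) b01 dh1 (dirichletC dh) dg.
have /andP[Z0 Z1] := average01 dg (dirichlet01 (sB _) (@hB _) dh1 b01).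
move: E X01 Y01; rewrite (cardsD1 i) iB add1n exprS; rewrite /odds_le in o1 o2.
set X := average g h in o1 o2 *; set Y := average g h0 in o1 o2 *.
set Z := average g h1 in o1 o2 Z0 Z1 *; set T := _ ^+ _ in o1 o2 *.
set t := u / l in o1 o2 * => EX /andP[X0 X1] /andP[Y0 Y1].
have Zp : 0 < Z.
  rewrite lt_neqAle Z0 andbT; apply/eqP => Zz.
  by move: o2; rewrite -Zz mul0r mulr0; lra.
have Zp1 : Z < 1.
  rewrite lt_neqAle Z1 andbT; apply/eqP => Zz.
  by move: o1; rewrite Zz subrr !mulr0; lra.
(* The bounds from [Y] to [Z] and from [Z] to [X] compose to an equality, so the second cannot be
   strict. *)
have E2 : X * (1 - Z) = t * (Z * (1 - X)).
  apply/eqP; rewrite eq_le o2 /= leNgt; apply/negP => lt2.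
  have p1 : 0 < Z * (1 - Y) by rewrite mulr_gt0 // subr_gt0.
  have t0 : 0 <= t * (Z * (1 - X)).
    by rewrite !mulr_ge0 ?subr_ge0 ?invr_ge0 ?ltW // (lt_le_trans l0).
  have := ler_wpM2l t0 o1.
  have := lt2; rewrite -(ltr_pM2r p1) => lt3 le3.
  have : X * (1 - Y) * (Z * (1 - Z)) < t * T * (Y * (1 - X)) * (Z * (1 - Z)).
    by apply: lt_le_trans (_ : t * (Z * (1 - X)) * (Z * (1 - Y)) <= _); lra.
  by rewrite EX ltxx.
exists h1.
have Z01 : 0 < Z < 1 by rewrite Zp.
have [hi supp] := row_change_odds_eq (sB _) (sB _) (@hB _) (@hB _) iD (hybrid_same iB)
  l0 (fun j => hybrid_ratio j iB) b01 dh1 (dirichletC dh) dg ltlu Z01 X1 E2.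
split=> //; exact: (row_change_gap (sB _) (@hB _) (hybrid_same iB) b01 dh1 (dirichletC dh) hi).
Qed.

(** The gap [h - h1] is zero on [D] and positive at [i], so its maximum is taken off [D]. At
    [j != i] both functions use row [P' j], so a maximal gap at [j] passes to all successors of
    [j]. *)
Let last_row_closed i h1 j k : i \notin D ->
  dirichlet (hybrid (~: D :\ i)) D b (fun=> 0) h1 -> h1 i < h i ->
  (forall j, h j - h1 j <= h i - h1 i) ->
  j != i -> h j - h1 j = h i - h1 i -> j \notin D /\
  (P' j k != 0 -> h k - h1 k = h i - h1 i).
Proof.
move=> iD dh1 hi gap ji hj.
have jD : j \notin D.
  by apply/negP => jD; move: hj; rewrite dh.1 // dh1.1 // subrr; lra.
split=> // Pjk; suff: - (h k - h1 k) = - (h i - h1 i) by move/oppr_inj.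
apply: (avg_eq_min (h := fun k => - (h k - h1 k)) (sP' j) _ _ Pjk).
  by move=> k'; rewrite lerN2.
under eq_bigr do rewrite mulrN mulrBr.
rewrite sumrN sumrB -hj lerN2 {1}dh.2 // addr0 {1}dh1.2 // addr0.
by rewrite /hybrid !inE ji jD.
Qed.

Lemma all_rows_odds_eq : (#|~: D| <= 1)%N.
Proof.
rewrite leqNgt; apply/negP => /card_gt1P[i1 [i2 [i1D i2D i12]]].
rewrite !inE in i1D i2D.
pose exits i := [exists d in D, P' i d != 0].
have notin_D i h1 d : h1 i < h i -> d \in D ->
    dirichlet (hybrid (~: D :\ i)) D b (fun=> 0) h1 -> h d - h1 d <> h i - h1 i.
  by move=> hi dD dh1; rewrite dh.1 // dh1.1 // subrr; lra.
(* If [i] and [j] both led into [D], the states where both gaps are maximal would exclude [i] and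
   [j], contain the support of [g] and be closed off [D], against [hits]. *)
have exits_uniq i j : i \notin D -> j \notin D -> exits i -> exits j -> i = j.
  move=> iD jD /existsP[d /andP[dD Pid]] /existsP[e /andP[eD Pje]].
  apply/eqP; case: eqVneq => // ij.
  have [hi [dhi lti gapi suppi]] := last_row iD.
  have [hj [dhj ltj gapj suppj]] := last_row jD.
  have nji : h j - hi j <> h i - hi i.
    move=> eq; have [//|_ /(_ Pje)] := last_row_closed e iD dhi lti gapi _ eq.
      by rewrite eq_sym.
    exact: notin_D.
  have nij : h i - hj i <> h j - hj j.
    move=> eq; have [//|_ /(_ Pid)] := last_row_closed d jD dhj ltj gapj _ eq.
    exact: notin_D.
  have [s gs] : exists s, g s != 0.
    apply/existsP; rewrite -negb_forall; apply/negP => /forallP g0.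
    have := dg.2; rewrite big1 => [/esym/eqP|k _]; first by rewrite oner_eq0.
    by rewrite (eqP (g0 k)).
  have : [set k | (h k - hi k == h i - hi i) && (h k - hj k == h j - hj j)] = finset.set0.
    apply: hP' => k; rewrite inE => /andP[/eqP ki /eqP kj].
    have kNi : k != i by apply/eqP => eq; rewrite eq in kj.
    have kNj : k != j by apply/eqP => eq; rewrite eq in ki.
    split=> [|k' Pkk']; first by have [] := last_row_closed k iD dhi lti gapi kNi ki.
    have [_ /(_ Pkk') ei] := last_row_closed k' iD dhi lti gapi kNi ki.
    have [_ /(_ Pkk') ej] := last_row_closed k' jD dhj ltj gapj kNj kj.
    by rewrite inE ei ej !eqxx.
  by move/setP/(_ s); rewrite !inE suppi // suppj // !eqxx.
have [i0 [i0D ex0]] : exists i0, i0 \notin D /\ exits i0.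
  apply: contrapT => noex.
  have : ~: D = finset.set0.
    apply: hP' => i; rewrite inE => iD; split=> // j Pij; rewrite inE.
    by apply/negP => jD; apply: noex; exists i; split=> //; apply/existsP; exists j; rewrite jD.
  by move/setP/(_ i1); rewrite !inE i1D.
have [i [iD ii0]] : exists i, i \notin D /\ i != i0.
  by case: (eqVneq i1 i0) => [e|]; [exists i2; split; rewrite -?e // eq_sym|exists i1].
have [h1 [dh1 lt1 gap1 _]] := last_row iD.
have sole k : k \notin D -> k != i0 -> forall d, d \in D -> P' k d = 0.
  move=> kD ki0 d dD; apply/eqP; rewrite -[_ == _]negbK; apply/negP => Pkd.
  move/eqP: ki0; apply; apply: exits_uniq => //.
  by apply/existsP; exists d; rewrite dD.
have sole1 k : k \notin D -> k != i0 -> forall d, d \in D -> hybrid (~: D :\ i) k d = 0.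
  move=> kD ki0 d dD; rewrite /hybrid; case: ifP => _; first exact: sole.
  have := ratio k d; rewrite sole // => /andP[+ _].
  rewrite pmulr_rle0 // => P0; apply/eqP; rewrite eq_le P0; exact: (sP k).1.
(* With the single exit [i0], both [h] and [h1] are constant off [D]. So [i0] shares the maximal gap
   of [i] and would pass it on to a state of [D]. *)
have c0 := dirichlet_sole_exit sP' hP' i0D dh sole iD.
have c1 := dirichlet_sole_exit (sB _) (@hB _) i0D dh1 sole1 iD.
have eq0 : h i0 - h1 i0 = h i - h1 i by rewrite c0 c1.
move: ex0 => /existsP[d /andP[dD Pd]].
have i0i : i0 != i by rewrite eq_sym.
have [_ /(_ Pd)] := last_row_closed d iD dh1 lt1 gap1 i0i eq0.
exact: notin_D.
Qed.

End Equality.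
End AllRows.


End Chains.

(** * Optimal stopping, and imitation by the other type *)

Section OptimalStopping.
Variables (R : realType) (n : nat).
Implicit Types (P : 'I_n -> 'I_n -> R) (D : {set 'I_n}) (a b h : 'I_n -> R).

(* [V] is the least superharmonic majorant of [a], and [D] is where it touches [a]. *)
Lemma optimal_stopping P a : stochastic P -> (forall i, 0 <= a i <= 1) ->
  exists V D, [/\ hits P D, dirichlet P D a (fun=> 0) V,
    forall i, a i <= V i & forall i, \sum_j P i j * V j <= V i].
Proof.
move=> sP a01.
pose E v := (forall i, a i <= v i) /\ (forall i, \sum_j P i j * v j <= v i).
pose A i : set R := fun x => exists2 v, E v & v i = x.
have E1 : E (fun=> 1).
  split=> i; first by have /andP[] := a01 i.
  by under eq_bigr do rewrite mulr1; rewrite (sP i).2.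
have A0 i : (A i !=set0)%classic by exists 1, (fun=> 1).
have Alb i : lbound (A i) (a i) by move=> x [v [av _] <-].
pose V i := inf (A i).
have Vmin v : E v -> forall i, V i <= v i.
  by move=> Ev i; apply: inf_lbound; [exists (a i)|exists v].
have leV i x : (forall v, E v -> x <= v i) -> x <= V i.
  by move=> H; apply: lb_le_inf => // _ [v Ev <-]; exact: H.
have aV i : a i <= V i by apply: leV => v [+ _]; exact.
have mono i v w : (forall j, v j <= w j) -> \sum_j P i j * v j <= \sum_j P i j * w j.
  by move=> vw; apply: ler_sum => j _; rewrite ler_wpM2l // (sP i).1.
have PV i : \sum_j P i j * V j <= V i.
  by apply: leV => v Ev; apply: le_trans (Ev.2 i); apply: mono; exact: Vmin.
pose D : {set 'I_n} := [set i | a i == V i].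
have notD i : i \notin D -> a i < V i by rewrite inE lt_neqAle aV andbT.
exists V, D; split=> //.
(* On a closed set off [D], [V] could be lowered by the least margin [V k - a k], against its
   minimality. *)
- move=> C hC; have [//|[i0 i0C]] := finset.set_0Vmem C.
  have [k kC kmin] := @arg_minP _ _ _ i0 (fun i => i \in C) (fun i => V i - a i) i0C.
  have e0 : 0 < V k - a k by rewrite subr_gt0 notD //; have [] := hC k kC.
  pose v i := if i \in C then V i - (V k - a k) else V i.
  have vV i : v i <= V i by rewrite /v; case: ifP => // _; lra.
  have Ev : E v.
    split=> i.
      rewrite /v; case: ifP => // iC; have := kmin i iC; lra.
    rewrite {2}/v; case: ifP => iC; last by apply: le_trans (PV i); exact: mono.
    have -> : \sum_j P i j * v j = \sum_j P i j * (V j - (V k - a k)).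
      apply: eq_bigr => j _; rewrite /v; case: ifP => // jC.
      have /eqP -> : P i j == 0; last by rewrite !mul0r.
      apply: contraFT jC; exact: (hC i iC).2.
    by rewrite avg_subr // lerB.
  by have := Vmin _ Ev k; rewrite /v kC leNgt gtrBl e0.
- split=> [i|i iD]; first by rewrite inE => /eqP.
  rewrite addr0; apply/eqP; rewrite eq_le PV andbT leNgt; apply/negP => lt.
  (* If [V] exceeded its average at [i], lowering it at [i] alone would give a smaller element of
     [E]. *)
  pose v j := if j == i then Num.max (a i) (\sum_j P i j * V j) else V j.
  have vi : v i < V i by rewrite /v eqxx gt_max notD.
  have vV j : v j <= V j by have [->|ji] := eqVneq j i; [exact: ltW|rewrite /v (negbTE ji)].
  have Ev : E v.
    split=> j.
      by rewrite /v; case: eqVneq => [->|_] //; rewrite le_max lexx.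
    apply: (@le_trans _ _ (\sum_k P j k * V k)); first exact: mono.
    by rewrite /v; case: eqVneq => [->|_] //; rewrite le_max lexx orbT.
  by have := Vmin _ Ev i; rewrite leNgt vi.
Qed.

Lemma dirichlet_const P D b x h : stochastic P -> hits P D ->
  dirichlet P D b (fun=> 0) h -> (forall i, i \in D -> b i = x) -> forall i, h i = x.
Proof.
move=> sP hP dh bx; apply: (dirichlet_unique sP hP dh); split=> i iD; first by rewrite bx.
by rewrite -mulr_suml (sP i).2 mul1r addr0.
Qed.

Section Persuasion.
Variables (P P' : 'I_n -> 'I_n -> R) (l u : R) (a g : 'I_n -> R).
Hypotheses (sP : stochastic P) (sP' : stochastic P') (l0 : 0 < l) (lu : l <= u).
Hypothesis ratio : forall i j, l * P i j <= P' i j <= u * P i j.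
Hypothesis a01 : forall j, 0 <= a j <= 1.
Hypothesis dg : is_dist g.

(** [P'] is meant for type H and [P] for type L: [V] is the value of H's stopping problem, [D] her
    stopping set, and [h] what L gets by stopping on [D] too. *)
Lemma mimicking_odds : exists V D h,
  let X := average g V in let Y := average g h in
  [/\ hits P D, dirichlet P D a (fun=> 0) h,
      (forall i, a i <= V i) /\ (forall i, \sum_j P' i j * V j <= V i),
      (0 <= X <= 1) /\ (0 <= Y <= 1) & odds_le ((u / l) ^+ (n - 2)) Y X /\
      ((4 <= n)%N -> l < u -> 0 < X < 1 -> 0 < Y < 1 ->
       X * (1 - Y) <> (u / l) ^+ (n - 2) * (Y * (1 - X)))].
Proof.
have [V [D [hP' dV aV PV]]] := optimal_stopping sP' a01.
have hP : hits P D.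
  apply: eq_support_hits hP' => i j _; apply: contra => /eqP P0.
  by have := ratio i j; rewrite P0 !mulr0 eq_le andbC.
have [h dh] := dirichlet_exists a (fun=> 0) sP hP.
have X01 := average01 dg (dirichlet01 sP' hP' dV a01).
have Y01 := average01 dg (dirichlet01 sP hP dh a01).
have t1 : 1 <= u / l by rewrite ler_pdivlMr // mul1r.
have YX0 : 0 <= average g h * (1 - average g V).
  by move: X01 Y01 => /andP[? ?] /andP[? ?]; rewrite mulr_ge0 ?subr_ge0.
exists V, D, h; split=> //.
have [D1|D2] := leqP #|D| 1.
  (* All of [D] carries one reward, so both types obtain exactly that reward. *)
  have [x Dx] : exists x, forall i, i \in D -> a i = x.
    have [->|[d dD]] := finset.set_0Vmem D; first by exists 0 => i; rewrite inE.
    by exists (a d) => i iD; rewrite (card_le1_eqP D1 i d).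
  have YX : average g h = average g V.
    by apply: eq_bigr => i _; rewrite (dirichlet_const sP hP dh Dx)
      (dirichlet_const sP' hP' dV Dx).
  rewrite /odds_le YX; rewrite YX in YX0; split.
    by rewrite -[leLHS]mul1r ler_wpM2r // exprn_ege1.
  move=> n4 ltlu /andP[X0 X1] _ E.

  have t1' : 1 < u / l by rewrite ltr_pdivlMr // mul1r.
  have T1 : 1 < (u / l) ^+ (n - 2).
    by rewrite exprn_egt1 // -lt0n subn_gt0; apply: leq_trans n4.
  have pos : 0 < average g V * (1 - average g V) by rewrite mulr_gt0 // subr_gt0.
  by move: E; rewrite -(ltr_pM2r pos) mul1r in T1; move=> E; rewrite -E ltxx in T1.
have dis : [disjoint ~: D & D] by rewrite disjoint_subset; apply/fintype.subsetP => j; rewrite !inE.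
(* Here [D] has at least two elements. *)
have kle : (#|~: D| <= n - 2)%N.
  have := cardsC D; rewrite card_ord => cardD.
  by rewrite -[X in (_ <= X - 2)%N]cardD -addnBAC // leq_addl.
have dV' : dirichlet (hybrid P P' (~: D)) D a (fun=> 0) V.
  by split=> [|i iD]; [exact: dV.1|rewrite {1}dV.2 // /hybrid inE iD].
have odds := all_rows_odds sP sP' hP l0 lu ratio a01 dg dis dh dV'.
split.
  by apply: le_trans odds _; rewrite ler_wpM2r // ler_weXn2l.
move=> n4 ltlu X0 Y0 E.
have t1' : 1 < u / l by rewrite ltr_pdivlMr // mul1r.
have pos : 0 < average g h * (1 - average g V).
  by move: X0 Y0 => /andP[? ?] /andP[? ?]; rewrite mulr_gt0 ?subr_gt0.
(* Equality with the exponent [n - 2] leaves exactly [n - 2 >= 2] states off [D], against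
   [all_rows_odds_eq]. *)
have keq : #|~: D| = (n - 2)%N.
  apply/eqP; rewrite eqn_leq kle /= -(ler_eXn2l t1') -(ler_pM2r pos) -E.
  exact: odds.
have := all_rows_odds_eq sP sP' hP l0 lu ratio a01 dg ltlu dh dV X0 Y0.
by rewrite keq => /(_ E); rewrite leqNgt ltn_subRL n4.
Qed.

End Persuasion.

End OptimalStopping.

(** * Payoffs as sums over time *)

Section Payoffs.
Variables (R : realType) (S : finType) (n : nat).
Implicit Types (D : {set 'I_n}) (b v r : 'I_n -> R).

Lemma cvg_fin_sum (I : finType) (u : I -> nat -> R) (l : I -> R) :
  (forall i, (u i N @[N --> \oo] --> l i)%classic) ->
  ((fun N => \sum_i u i N) N @[N --> \oo] --> \sum_i l i)%classic.
Proof.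
move=> ul.
rewrite -[X in (X @ _ --> _)%classic]/(fun N => \sum_i u i N).
elim: (index_enum I) => [|i s IHs].
  under eq_cvg do rewrite big_nil.
  by rewrite big_nil; exact: cvg_cst.
under eq_cvg do rewrite big_cons.
by rewrite big_cons; apply: cvgD.
Qed.

Lemma nonneg_series_cvg (u : nat -> R) (M : R) : (forall t, 0 <= u t) ->
  (forall N, series u N <= M) -> cvgn (series u).
Proof.
move=> u0 uM; apply: nondecreasing_is_cvgn.
  by apply: nondecreasing_series => t _ _; exact: u0.
by exists M => _ [N _ <-]; exact: uM.
Qed.

Definition kernel (pi : bool -> S -> R) (f : 'I_n -> S -> 'I_n -> R) th i j :=
  \sum_s pi th s * f i s j.

Variables (pi : bool -> S -> R) (f : 'I_n -> S -> 'I_n -> R) (g : 'I_n -> R).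
Hypothesis pi_gt0 : forall th s, 0 < pi th s.
Hypothesis pi_sum : forall th, \sum_(s : S) pi th s = 1.
Hypothesis df : forall i s, is_dist (f i s).
Hypothesis dg : is_dist g.

Lemma kernel_stochastic th : stochastic (kernel pi f th).
Proof.
move=> i; split=> [j|].
  by apply: sumr_ge0 => s _; rewrite mulr_ge0 ?(ltW (pi_gt0 _ _)) ?(df i s).1.
rewrite exchange_big /= -(pi_sum th); apply: eq_bigr => s _.
by rewrite -mulr_sumr (df i s).2 mulr1.
Qed.

Variables (sigma : 'I_n -> bool -> R) (th : bool).
Hypothesis vs : valid_strategy sigma.

Let P := kernel pi f th.
Let w := stopw f sigma th.
Let mass := occ pi f g sigma th.

Lemma stopw01 i : 0 <= stopw f sigma th i <= 1.
Proof. by rewrite /stopw; case: ifP => _; rewrite ?ler01 ?lexx ?vs. Qed.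

Lemma occ_ge0 t i : 0 <= occ pi f g sigma th t i.
Proof.
elim: t i => [|t IH] i /=; first exact: dg.1.
apply: sumr_ge0 => j _; rewrite !mulr_ge0 //; last first.
  exact: (kernel_stochastic th j).1.
by rewrite subr_ge0; have /andP[] := stopw01 j.
Qed.

Lemma occ_step t v : \sum_j mass t.+1 j * v j =
  \sum_i mass t i * ((1 - w i) * \sum_j P i j * v j).
Proof.
rewrite /mass /=; under eq_bigr do rewrite mulr_suml.
rewrite exchange_big /=; apply: eq_bigr => i _.
by rewrite !mulr_sumr; apply: eq_bigr => j _; rewrite /P /kernel -!mulrA.
Qed.

(** With reward [r] per visit, the expected [v] over plays still running falls each period by at
    least the reward paid; the sum telescopes. *)
Lemma visits_le r v : (forall i, r i + (1 - w i) * (\sum_j P i j * v j) <= v i) ->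
  forall N, \sum_i r i * series (mass ^~ i) N + \sum_i mass N i * v i <= average g v.
Proof.
move=> rv; elim=> [|N IHN].
  rewrite big1 ?add0r // => i _; by rewrite /series /= big_geq ?mulr0.
apply: le_trans IHN; rewrite occ_step.
under eq_bigr do rewrite seriesSr mulrDr.
rewrite big_split /= -addrA lerD2l -big_split /=.
apply: ler_sum => i _; rewrite [r i * _]mulrC -mulrDr ler_wpM2l ?rv //.
exact: occ_ge0.
Qed.

Lemma visits_ge r v : (forall i, v i <= r i + (1 - w i) * (\sum_j P i j * v j)) ->
  forall N, average g v <= \sum_i r i * series (mass ^~ i) N + \sum_i mass N i * v i.
Proof.
move=> rv N.
have opp (x y : 'I_n -> R) : \sum_i x i * - y i = - \sum_i x i * y i.
  by under eq_bigr do rewrite mulrN; rewrite sumrN.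
have := @visits_le (fun i => - r i) (fun i => - v i) _ N.
rewrite /average !opp; under eq_bigr do rewrite mulNr.
rewrite sumrN -opprD lerN2; apply=> i.
by rewrite opp mulrN -opprD lerN2.
Qed.

Let series_mass_ge0 N i : 0 <= series (mass ^~ i) N.
Proof. by apply: sumr_ge0 => t _; exact: occ_ge0. Qed.

(** By [visits_le] with [r = w] and [v = 1] the partial sums are at most 1, so the [limn] in
    [endprob] is a true limit. *)
Lemma endprob_cvg i :
  (w i * series (mass ^~ i) N @[N --> \oo] --> endprob pi f g sigma th i)%classic.
Proof.
have E N : w i * series (mass ^~ i) N = series (fun t => mass t i * w i) N.
  by rewrite /series /= mulr_sumr; apply: eq_bigr => t _; rewrite mulrC.
under eq_cvg do rewrite E.
apply: (@nonneg_series_cvg _ 1) => [t|N].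
  by rewrite mulr_ge0 ?occ_ge0 //; have /andP[] := stopw01 i.
rewrite -E; have := @visits_le w (fun=> 1) _ N.
rewrite average_cst // => H; apply: le_trans (H _); last first.
  move=> j; under eq_bigr do rewrite mulr1.
  by rewrite (kernel_stochastic th j).2 mulr1 addrC subrK.
rewrite (bigD1 i) //= -addrA lerDl addr_ge0 // sumr_ge0 // => j _.
  by rewrite mulr_ge0 //; have /andP[] := stopw01 j.
by rewrite mulr1 occ_ge0.
Qed.

Lemma payoff_cvg b : (\sum_i (w i * b i) * series (mass ^~ i) N @[N --> \oo] -->
  \sum_i endprob pi f g sigma th i * b i)%classic.
Proof.
apply: cvg_fin_sum => i.
under eq_cvg do rewrite mulrAC.
by apply: cvgMl; exact: endprob_cvg.
Qed.

(** Optional stopping: [visits_le] applies with reward [w * b], and the value still pending after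
    [N] periods is nonnegative. *)
Lemma payoff_le b v : (forall i, 0 <= v i) -> (forall i, b i <= v i) ->
  (forall i, \sum_j P i j * v j <= v i) ->
  \sum_i endprob pi f g sigma th i * b i <= average g v.
Proof.
move=> v0 bv Pv; rewrite -(cvg_lim _ (@payoff_cvg b)) //.
apply: limr_le; first by apply: cvgP; exact: payoff_cvg.
near=> N; have := @visits_le (fun i => w i * b i) v _ N.
have vN : 0 <= \sum_i mass N i * v i.
  by apply: sumr_ge0 => i _; rewrite mulr_ge0 ?occ_ge0.
move=> H; apply: le_trans (H _); first by rewrite lerDl.
move=> i; have /andP[w0 w1] := stopw01 i.
have w1' : 0 <= 1 - w i by rewrite subr_ge0.
by have := ler_wpM2l w0 (bv i); have := ler_wpM2l w1' (Pv i); rewrite -/w; lra.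
Unshelve. all: by end_near. Qed.

Lemma endprob_sum_le1 : \sum_i endprob pi f g sigma th i <= 1.
Proof.
have := @payoff_le (fun=> 1) (fun=> 1).
rewrite average_cst //; under eq_bigr do rewrite mulr1.
by apply=> // i; under eq_bigr do rewrite mulr1; rewrite (kernel_stochastic th i).2.
Qed.

Section StopOnHitting.
Variables (D : {set 'I_n}).
Hypotheses (hP : hits P D) (wD : forall i, i \in D -> w i = 1)
  (wND : forall i, i \notin D -> w i = 0).

(* The expected number of periods is bounded by the solution of [u = P u + 1]. *)
Lemma occ_vanishes i : (mass N i @[N --> \oo] --> (0 : R))%classic.
Proof.
have sP := kernel_stochastic th.
have [u [uD uP]] := dirichlet_exists (fun=> 1) (fun=> 1) sP hP.
have u0 j : 0 <= u j.
  apply: (minimum_principle sP hP) => k kD; first by rewrite uD.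
  by rewrite [leRHS]uP // lerDl.
apply: cvg_series_cvg_0; apply: (@nonneg_series_cvg _ (average g u)) => [t|N].
  exact: occ_ge0.
apply: le_trans (@visits_le (fun=> 1) u _ N); last first.
  move=> j; have [jD|jD] := boolP (j \in D).
    by rewrite wD // uD // subrr mul0r addr0.
  by rewrite wND // [leRHS]uP // subr0 mul1r addrC.
under [X in _ <= X + _]eq_bigr do rewrite mul1r.
rewrite (bigD1 i) //= -addrA lerDl addr_ge0 // sumr_ge0 // => j _.
by rewrite mulr_ge0 ?occ_ge0.
Qed.

(** Both [visits_le] and [visits_ge] apply, so the payoff up to [N] is [average g h] minus a pending
    value, which vanishes by [occ_vanishes]. *)
Lemma payoff_dirichlet b h : dirichlet P D b (fun=> 0) h ->
  \sum_i endprob pi f g sigma th i * b i = average g h.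
Proof.
move=> [hD hh].
have step i : h i = w i * b i + (1 - w i) * \sum_j P i j * h j.
  have [iD|iD] := boolP (i \in D).
    by rewrite wD // hD // subrr mul0r mul1r addr0.
  by rewrite wND // {1}hh // mul0r subr0 mul1r add0r addr0.
have E N : \sum_i (w i * b i) * series (mass ^~ i) N =
    average g h - \sum_i mass N i * h i.
  apply/eqP; rewrite eq_sym subr_eq eq_le visits_le ?visits_ge // => i;
  by rewrite -step.
have c0 : (\sum_i mass N i * h i @[N --> \oo] --> \sum_i (0 : R) * h i)%classic.
  by apply: cvg_fin_sum => i; apply: cvgMl; exact: occ_vanishes.
rewrite big1 in c0 => [|i _]; last by rewrite mul0r.
rewrite -(cvg_lim _ (@payoff_cvg b)) //; apply: cvg_lim => //.
under eq_cvg do rewrite E.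
rewrite -[in X in nbhs X](subr0 (average g h)).
by apply: cvgB => //; exact: cvg_cst.
Qed.

End StopOnHitting.
End Payoffs.

(** * From the odds bound to the receiver's payoff *)

(** [A] and [B] are the errors in states H and L, rescaled so that [A * B - G] is [G - 1] times the
    slack of the odds bound. AM-GM is then applied to [p * A] and [(1 - p) * B]. *)
Lemma error_AMGM (R : realType) (p G X Y : R) :
  0 < p < 1 -> 1 < G -> 0 <= X <= 1 -> 0 <= Y <= 1 -> odds_le G Y X ->
  let r := Num.sqrt (p * (1 - p) * G) in
  let A := 1 + (G - 1) * (1 - X) in
  let B := 1 + (G - 1) * Y in
  2 * r <= p * A + (1 - p) * B /\
  (p * A + (1 - p) * B = 2 * r -> [/\ A * B = G, p * A = r & (1 - p) * B = r]).
Proof.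
move=> /andP[p0 p1] G1 /andP[X0 X1] /andP[Y0 Y1] odds r A B.
have q0 : 0 < 1 - p by rewrite subr_gt0.
have pq0 : 0 < p * (1 - p) by rewrite mulr_gt0.
have c0 : 0 < G - 1 by rewrite subr_gt0.
have r2 : r * r = p * (1 - p) * G.
  by rewrite -expr2 sqr_sqrtr // mulr_ge0 // ltW // (lt_trans ltr01).
have r0 : 0 <= r by exact: sqrtr_ge0.
have A0 : 0 < A by rewrite ltr_pwDl // mulr_ge0 ?subr_ge0 // ltW.
have B0 : 0 < B by rewrite ltr_pwDl // mulr_ge0 // ltW.
have AB : G <= A * B.
  have odds' : 0 <= G * (Y * (1 - X)) - X * (1 - Y) by rewrite subr_ge0.
  by have := mulr_ge0 (ltW c0) odds'; rewrite /A /B; lra.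
have sq : (p * A + (1 - p) * B) ^+ 2 =
    (p * A - (1 - p) * B) ^+ 2 + 4 * (p * (1 - p) * (A * B)) by ring.
have le4 : 4 * (r * r) <= 4 * (p * (1 - p) * (A * B)).
  by rewrite ler_pM2l // r2 ler_pM2l.
have S0 : 0 <= p * A + (1 - p) * B by rewrite addr_ge0 // mulr_ge0 // ltW.
have d0 := sqr_ge0 (p * A - (1 - p) * B).
split=> [|E].
  by rewrite -(@ler_pXn2r _ 2) ?nnegrE ?mulr_ge0 // sq expr2; lra.
have E2 : (p * A + (1 - p) * B) ^+ 2 = 4 * (r * r) by rewrite E; ring.
have d00 : (p * A - (1 - p) * B) ^+ 2 = 0 by lra.
have eqAB : p * A - (1 - p) * B = 0 by apply/eqP; rewrite -sqrf_eq0 d00.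
have AG : p * (1 - p) * (A * B) = p * (1 - p) * G by lra.
split; [|lra..].
by apply: (mulfI _ AG); rewrite gt_eqF.
Qed.

Lemma kappa_lt (R : realType) (p G : R) : 0 < p < 1 ->
  (kappa p < G) = (p < G * (1 - p)) && (1 - p < G * p).
Proof.
move=> /andP[p0 p1]; rewrite /kappa gt_max !ltr_pdivrMr // ?subr_gt0 //.
Qed.

Lemma kappa_ge1 (R : realType) (p : R) : 0 < p < 1 -> 1 <= kappa p.
Proof. by move=> p01; rewrite leNgt kappa_lt //; lra. Qed.

(** The AM-GM sum is affine in the error. At equality [A = r / p] and [B = r / (1 - p)], and
    [kappa p < G] puts both strictly between 1 and [G], so [X] and [Y] are interior. *)
Lemma receiver_bound_informative (R : realType) (p G X Y : R) :
  0 < p < 1 -> kappa p < G -> 0 <= X <= 1 -> 0 <= Y <= 1 -> odds_le G Y X ->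
  let v := 1 - (2 * Num.sqrt (p * (1 - p) * G) - 1) / (G - 1) in
  p * X + (1 - p) * (1 - Y) <= v /\
  (p * X + (1 - p) * (1 - Y) = v ->
   [/\ 0 < X < 1, 0 < Y < 1 & X * (1 - Y) = G * (Y * (1 - X))]).
Proof.
move=> p01 kG X01 Y01 odds.
have G1 : 1 < G by apply: le_lt_trans kG; exact: kappa_ge1.
have c0 : 0 < G - 1 by rewrite subr_gt0.
have := error_AMGM p01 G1 X01 Y01 odds.
set r := Num.sqrt _; set A := 1 + _ * _; set B := 1 + _ * _ => -[le eq] v.
have errE : p * A + (1 - p) * B =
    1 + (G - 1) * (1 - (p * X + (1 - p) * (1 - Y))) by rewrite /A /B; ring.
have vE : 1 + (G - 1) * (1 - v) = 2 * r by rewrite /v; field; rewrite gt_eqF.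
split.
  by rewrite -(lerN2) -(lerD2l 1) -(ler_pM2l c0) -(lerD2l 1) -errE vE.
move=> E; have [|AB Ar Br] := eq; first by rewrite errE E vE.
move: kG; rewrite kappa_lt // => /andP[k1 k2].
move: (p01) => /andP[p0 p1].
have q0 : 0 < 1 - p by rewrite subr_gt0.
have r2 : r * r = p * (1 - p) * G by rewrite -AB -{1}Ar -Br; ring.
have r0 : 0 <= r by exact: sqrtr_ge0.
have sqlt (x y : R) : 0 <= x -> 0 <= y -> x * x < y * y -> x < y.
  by move=> x0 y0; rewrite -!expr2 ltr_pXn2r.
have G0 : 0 < G by apply: lt_trans G1.
have pr : p < r by apply: sqlt; [exact: ltW|exact: r0|]; rewrite r2 -mulrA ltr_pM2l // mulrC.
have qr : 1 - p < r.
  apply: sqlt; [exact: ltW|exact: r0|rewrite r2].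
  have -> : p * (1 - p) * G = (1 - p) * (G * p) by ring.
  by rewrite ltr_pM2l.
have rp : r < G * p.
  apply: sqlt => //; first by rewrite mulr_ge0 // ltW.
  have -> : r * r = (G * p) * (1 - p) by rewrite r2; ring.
  by rewrite ltr_pM2l // mulr_gt0.
have rq : r < G * (1 - p).
  apply: sqlt => //; first by rewrite mulr_ge0 // ltW.
  have -> : r * r = (G * (1 - p)) * p by rewrite r2; ring.
  by rewrite ltr_pM2l // mulr_gt0.
have A1 : 1 < A by rewrite -(ltr_pM2l p0) mulr1 Ar.
have A2 : A < G by rewrite -(ltr_pM2l p0) Ar mulrC.
have B1 : 1 < B by rewrite -(ltr_pM2l q0) mulr1 Br.
have B2 : B < G by rewrite -(ltr_pM2l q0) Br mulrC.
split.
- apply/andP; split.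
    by rewrite -(ltr_pM2l c0) mulr0; move: A2; rewrite /A; lra.
  by rewrite -(ltr_pM2l c0) mulr1; move: A1; rewrite /A; lra.
- apply/andP; split.
    by rewrite -(ltr_pM2l c0) mulr0; move: B1; rewrite /B; lra.
  by rewrite -(ltr_pM2l c0) mulr1; move: B2; rewrite /B; lra.
apply: (mulfI (x := G - 1)); first by rewrite gt_eqF.
by move: AB; rewrite /A /B; lra.
Qed.

Lemma receiver_bound_uninformative (R : realType) (p G X Y : R) :
  0 < p < 1 -> 1 <= G <= kappa p -> 0 <= X <= 1 -> 0 <= Y <= 1 -> odds_le G Y X ->
  p * X + (1 - p) * (1 - Y) <= Num.max p (1 - p).
Proof.
move=> p01 /andP[G1 Gk] /andP[X0 X1] /andP[Y0 Y1] odds.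
move: Gk; rewrite leNgt kappa_lt // negb_and -!leNgt => /orP[k|k].
- apply: (@le_trans _ _ p); last by rewrite le_max lexx.
  (* The tangent to the odds frontier at [X = Y = 1]; the other case uses the tangent at
     [X = Y = 0]. *)
  have h : 1 <= G * (1 - X) + Y.
    have : 0 <= (G - 1) * ((1 - X) * (1 - Y)) by rewrite !mulr_ge0 ?subr_ge0.
    by move: odds; rewrite /odds_le; lra.
  have : (1 - p) * 1 <= (1 - p) * (G * (1 - X) + Y) by rewrite ler_wpM2l //; lra.
  have : G * (1 - p) * (1 - X) <= p * (1 - X) by rewrite ler_wpM2r // subr_ge0.
  by lra.
- apply: (@le_trans _ _ (1 - p)); last by rewrite le_max lexx orbT.
  have h : 1 <= G * Y + (1 - X).
    have : 0 <= (G - 1) * (Y * X) by rewrite !mulr_ge0 ?subr_ge0.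
    by move: odds; rewrite /odds_le; lra.
  have : p * 1 <= p * (G * Y + (1 - X)) by rewrite ler_wpM2l //; lra.
  have : G * p * Y <= (1 - p) * Y by rewrite ler_wpM2r.
  by lra.
Qed.

(** * Upper bound over all protocols *)

Section UpperBound.
Variables (R : realType) (S : finType) (p : R) (pi : bool -> S -> R) (m : nat).
Hypothesis p01 : 0 < p < 1.
Hypothesis pi_gt0 : forall th s, 0 < pi th s.
Hypothesis pi_sum : forall th, \sum_(s : S) pi th s = 1.

Lemma extreme_signals : exists hi lo,
  [/\ lbar pi = lratio pi hi, lunder pi = lratio pi lo,
      forall s, lratio pi s <= lratio pi hi & forall s, lratio pi lo <= lratio pi s].
Proof.
have r0 s : 0 <= lratio pi s by rewrite divr_ge0 // ltW.
(* A signal exists because probabilities sum to 1; hence the extremes are attained and the seeds [0]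
   and [lbar pi] are neutral. *)
have [s0 _] : exists s : S, True.
  apply: contrapT => noS; have := pi_sum true.
  rewrite big1 => [/esym/eqP|s _]; first by rewrite oner_eq0.
  by case: noS; exists s.
have ler_lbar s : lratio pi s <= lbar pi by exact: le_bigmax.
have := @bigmax_eq_arg _ _ _ 0 s0 xpredT (lratio pi) isT (fun s _ => r0 s).
have := @bigmin_eq_arg _ _ _ (lbar pi) s0 xpredT (lratio pi) isT (fun s _ => ler_lbar s).
rewrite -/(lunder pi) -/(lbar pi) => loE hiE.
do 2!eexists; split; [exact: hiE|exact: loE|move=> s..].
  by rewrite -hiE.
by rewrite -loE; exact: bigmin_le.
Qed.

Lemma lratio_gt0 s : 0 < lratio pi s.
Proof. by rewrite divr_gt0. Qed.

Lemma lunder_gt0 : 0 < lunder pi.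
Proof. by have [hi [lo [_ -> _ _]]] := extreme_signals; exact: lratio_gt0. Qed.

Lemma lunder_le_lbar : lunder pi <= lbar pi.
Proof. by have [hi [lo [-> -> hiP _]]] := extreme_signals. Qed.

Lemma gamma_ge1 : 1 <= gamma pi.
Proof. by rewrite ler_pdivlMr ?lunder_gt0 // mul1r lunder_le_lbar. Qed.

Lemma signal_ratio s : lunder pi * pi false s <= pi true s <= lbar pi * pi false s.
Proof.
have [hi [lo [-> -> hiP loP]]] := extreme_signals.
apply/andP; split; first by rewrite -ler_pdivlMr //; exact: loP.
by rewrite -ler_pdivrMr //; exact: hiP.
Qed.

Lemma kernel_ratio (f : 'I_m -> S -> 'I_m -> R) :
  (forall i s, is_dist (f i s)) -> forall i j,
  lunder pi * kernel pi f false i j <= kernel pi f true i j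
    <= lbar pi * kernel pi f false i j.
Proof.
move=> df i j; rewrite /kernel !mulr_sumr.
by apply/andP; split; apply: ler_sum => s _; rewrite mulrA ler_wpM2r ?(df i s).1 //;
  have /andP[] := signal_ratio s.
Qed.

Lemma eq_endprob (f : 'I_m -> S -> 'I_m -> R) g sigma sigma' th :
  (forall i, sigma i th = sigma' i th) ->
  endprob pi f g sigma th =1 endprob pi f g sigma' th.
Proof.
move=> E i.
have wE j : stopw f sigma th j = stopw f sigma' th j by rewrite /stopw E.
have oE t j : occ pi f g sigma th t j = occ pi f g sigma' th t j.
  by elim: t j => // t IH j /=; apply: eq_bigr => k _; rewrite IH wE.
rewrite /endprob; congr (limn (series _)).
by apply/funext => t; rewrite oE wE.
Qed.

(** An absorbing state alone is a closed set. Hence the forced end at absorbing states agrees with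
    stopping exactly on [D]. *)
Lemma absorbing_in (f : 'I_m -> S -> 'I_m -> R) th D i :
  (forall i s, is_dist (f i s)) -> hits (kernel pi f th) D ->
  absorbing f i -> i \in D.
Proof.
move=> df hP /forallP abs; apply: contraT => iD.
have : [set i] = finset.set0.
  apply: hP => k; rewrite inE => /eqP ->; split=> // j; apply: contraR.
  rewrite inE => ji; rewrite /kernel big1 // => s _.
  have := (df i s).2; rewrite (bigD1 i) //= (eqP (abs s)) => /eqP.
  rewrite -subr_eq0 addrC addrK psumr_eq0 => [/allP/(_ j)|k' _]; last exact: (df i s).1.
  by rewrite mem_index_enum ji => /(_ isT) /eqP ->; rewrite mulr0.
by move/setP/(_ i); rewrite !inE eqxx.
Qed.

(* Type [L] can imitate an optimal stopping rule of type [H]: this bounds from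
   below what a best response gives her. *)
Lemma receiver_payoff_bound (f : 'I_m -> S -> 'I_m -> R) g a sigma :
  valid_protocol f g a -> best_response p pi f g a sigma ->
  exists X Y, [/\ (0 <= X <= 1) /\ (0 <= Y <= 1),
    odds_le (gamma pi ^+ (m - 2)) Y X,
    UR p pi f g a sigma <= p * X + (1 - p) * (1 - Y) &
    (4 <= m)%N -> 1 < gamma pi -> 0 < X < 1 -> 0 < Y < 1 ->
    X * (1 - Y) <> gamma pi ^+ (m - 2) * (Y * (1 - X))].
Proof.
move=> [df [dg a01]] [vs br].
have sK := kernel_stochastic pi_gt0 pi_sum df.
have [V [D [h [hP dh [aV PV] X01Y01 [odds strict]]]]] :=
  mimicking_odds (sK false) (sK true) lunder_gt0 lunder_le_lbar (kernel_ratio df) a01 dg.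
set X := average g V in X01Y01 odds strict; set Y := average g h in X01Y01 odds strict.
exists X, Y; split=> //; last first.
  move=> m4 g1; apply: strict => //.
  by move: g1; rewrite ltr_pdivlMr ?lunder_gt0 // mul1r.
have [p0 p1] := andP p01.
have V0 i : 0 <= V i by apply: le_trans (aV i); have /andP[] := a01 i.
have VH : \sum_i endprob pi f g sigma true i * a i <= X.
  exact: payoff_le.
(* Only type L deviates, so the best-response inequality compares her payoffs alone. *)
pose sigma' (i : 'I_m) (th : bool) : R := if th then sigma i true else (i \in D)%:R.
have vs' : valid_strategy sigma'.
  by move=> i [] /=; rewrite /sigma'; [exact: vs|case: (i \in D); rewrite ?lexx ?ler01].
have VL' : \sum_i endprob pi f g sigma' false i * a i = Y.
  apply: (payoff_dirichlet pi_gt0 pi_sum df dg vs' hP) dh => i iD.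
    by rewrite /stopw /sigma' iD; case: ifP.
  rewrite /stopw /sigma' (negbTE iD); case: ifP => // /(absorbing_in df hP).
  by rewrite (negbTE iD).
have VL : Y <= \sum_i endprob pi f g sigma false i * a i.
  have := br _ vs'; rewrite /US !big_bool /= VL' .
  under eq_bigr do rewrite (@eq_endprob f g sigma' sigma true) //.
  by rewrite lerD2l ler_pM2l // subr_gt0.
rewrite /UR big_bool /=; apply: lerD; rewrite ler_wpM2l ?(ltW p0) //.
  by rewrite subr_ge0 ltW.
(* The game may fail to end, so action L has probability at most one minus that of action H. *)
under eq_bigr do rewrite mulrBr mulr1.
by rewrite sumrB lerB // endprob_sum_le1.
Qed.

End UpperBound.

(** * Protocols that ignore the signals *)

Section ConstantProtocols.
Variables (R : realType) (S : finType) (p : R) (pi : bool -> S -> R) (m : nat).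
Hypothesis pi_gt0 : forall th s, 0 < pi th s.
Hypothesis pi_sum : forall th, \sum_(s : S) pi th s = 1.

Lemma is_dist_delta (T : finType) (x : T) : is_dist (fun y => (y == x)%:R : R).
Proof.
split=> [y|]; first by case: eqP.
by rewrite (bigD1 x) //= eqxx big1 ?addr0 // => y /negbTE ->.
Qed.

(** Every state absorbs, so play ends at once and all strategies are best responses. *)
Lemma constant_action_value (x : R) : (0 < m)%N -> 0 <= x <= 1 ->
  receiver_values p pi m (p * x + (1 - p) * (1 - x)).
Proof.
move=> m0 x01; pose i0 := Ordinal m0.
pose f (i : 'I_m) (_ : S) (j : 'I_m) : R := (j == i)%:R.
pose g (j : 'I_m) : R := (j == i0)%:R.
have df i s : is_dist (f i s) := is_dist_delta i.
have dg : is_dist g := is_dist_delta i0.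
have hT th : hits (kernel pi f th) [set: 'I_m].
  by move=> C hC; apply/setP => i; rewrite inE; apply/negP => /hC[]; rewrite inE.
have absT i : absorbing f i by apply/forallP => s; rewrite /f eqxx.
have pay sigma th y : valid_strategy sigma ->
    \sum_i endprob pi f g sigma th i * y = y.
  move=> vs; rewrite -[RHS](average_cst _ dg).
  apply: (payoff_dirichlet pi_gt0 pi_sum df dg vs (hT th)) => [i _|i|].
  - by rewrite /stopw absT.
  - by rewrite inE.
  - by split=> i; rewrite inE.
have vs : valid_strategy (fun (i : 'I_m) (th : bool) => 1 : R).
  by move=> i th; rewrite ler01 lexx.
exists f, g, (fun=> x), (fun _ _ => 1); split; [|split].
- by split=> //; split.
- split=> // sigma' vs'; rewrite /US !big_bool /= !pay //.
- by rewrite /UR big_bool /= !pay.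
Qed.

End ConstantProtocols.

(** * The ladder protocol and its exact value *)

Section Ladder.
Variables (R : realType) (S : finType) (p : R) (pi : bool -> S -> R) (k : nat).
Hypothesis p01 : 0 < p < 1.
Hypothesis pi_gt0 : forall th s, 0 < pi th s.
Hypothesis pi_sum : forall th, \sum_(s : S) pi th s = 1.
Variables (hi lo : S) (eps eta : R).
Hypothesis hilo : hi != lo.
Hypothesis eps01 : 0 < eps <= 1.
Hypothesis eta01 : 0 < eta <= 1.

(* State 0 absorbs with action H, state [k + 2] with action L; the play starts
   in state 1. Since [eta] is of order [eps ^ k.+1], reaching either end is rare
   per attempt, and one reaches [k + 2] by [k + 1] signals [lo] without a reset by [hi]. *)
Definition rate (i : 'I_k.+3) (s : S) : R :=
  if (i == 0 :> nat) || (i == k.+2 :> nat) then 0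
  else if s == hi then (if i == 1 :> nat then eta else 1)
  else if s == lo then eps else 0.

Definition target (i : 'I_k.+3) (s : S) : 'I_k.+3 :=
  if s == hi then (if i == 1 :> nat then ord0 else inord 1) else inord i.+1.

Definition ladder (i : 'I_k.+3) (s : S) (j : 'I_k.+3) : R :=
  rate i s * (j == target i s)%:R + (1 - rate i s) * (j == i)%:R.

Definition ladder_init (j : 'I_k.+3) : R := (j == inord 1)%:R.

Definition ladder_action (i : 'I_k.+3) : R := (i == ord0)%:R.

Definition ladder_ends : {set 'I_k.+3} := [set i : 'I_k.+3 | (i == 0 :> nat) || (i == k.+2 :> nat)].

Lemma rate01 i s : 0 <= rate i s <= 1.
Proof.
have /andP[/ltW e0 e1] := eps01; have /andP[/ltW h0 h1] := eta01.
by rewrite /rate; do !case: ifP => _; rewrite ?lexx ?ler01 ?e0 ?h0.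
Qed.

Lemma sum_delta (v : 'I_k.+3 -> R) i : \sum_j (j == i)%:R * v j = v i.
Proof.
rewrite (bigD1 i) //= eqxx mul1r big1 ?addr0 // => j /negbTE ->.
exact: mul0r.
Qed.

Lemma ladder_avg (v : 'I_k.+3 -> R) i s :
  \sum_j ladder i s j * v j = v i + rate i s * (v (target i s) - v i).
Proof.
under eq_bigr do rewrite /ladder mulrDl -!mulrA.
by rewrite big_split /= -!mulr_sumr !sum_delta; ring.
Qed.

Lemma ladder_dist i s : is_dist (ladder i s).
Proof.
have /andP[r0 r1] := rate01 i s; split=> [j|].
  by rewrite addr_ge0 // mulr_ge0 ?subr_ge0 ?ler0n.
have := ladder_avg (fun=> 1) i s; under eq_bigr do rewrite mulr1.
by move=> ->; rewrite subrr mulr0 addr0.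
Qed.

Lemma ladder_kernel_avg th (v : 'I_k.+3 -> R) i :
  \sum_j kernel pi ladder th i j * v j =
  v i + \sum_s pi th s * (rate i s * (v (target i s) - v i)).
Proof.
rewrite -[X in X + _]mul1r -(pi_sum th) mulr_suml -big_split /=.
rewrite /kernel; under eq_bigr do rewrite mulr_suml.
rewrite exchange_big /=; apply: eq_bigr => s _.
rewrite -mulrDr -ladder_avg mulr_sumr; apply: eq_bigr => j _.
by rewrite mulrA.
Qed.

Lemma ladder_kernel_interior th (v : 'I_k.+3 -> R) i : i \notin ladder_ends ->
  \sum_j kernel pi ladder th i j * v j = v i +
  (pi th hi * ((if i == 1 :> nat then eta else 1) *
     (v (if i == 1 :> nat then ord0 else inord 1) - v i)) +
   pi th lo * (eps * (v (inord i.+1) - v i))).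
Proof.
rewrite inE => /negbTE iE; rewrite ladder_kernel_avg; congr (_ + _).
rewrite (bigD1 hi) //= (bigD1 lo) ?(eq_sym lo) //= big1; last first.
  move=> s /andP[/negbTE shi /negbTE slo].
  by rewrite /rate iE shi slo mul0r mulr0.
by rewrite addr0 /rate /target iE !eqxx [lo == hi]eq_sym (negbTE hilo).
Qed.

(** Each interior state moves up with positive probability, so a closed set would climb to the top
    end. *)
Lemma ladder_hits th : hits (kernel pi ladder th) ladder_ends.
Proof.
have [eps0 _] := andP eps01; have [eta0 _] := andP eta01.
move=> C hC; apply/setP => i; rewrite inE; apply/negP.
have [d] := ubnP (k.+3 - i)%N; elim: d => // d IH in i * => id iC.
have [iE hj] := hC i iC.
have ik : (i.+1 < k.+3)%N.
  move: iE; rewrite inE negb_or => /andP[_ i2].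
  by rewrite ltnS ltn_neqAle i2 -ltnS ltn_ord.
have iS : (inord i.+1 : 'I_k.+3) = i.+1 :> nat by rewrite inordK.
suff : (inord i.+1 : 'I_k.+3) \in C.
  by apply: IH; rewrite iS; move: id; rewrite !ltnS => /(leq_trans _); apply; rewrite ltn_sub2l // ltnW.
apply: hj; rewrite gt_eqF //.
pose v (j : 'I_k.+3) : R := (j == inord i.+1)%:R.
have vi : v i = 0.
  rewrite /v; case: eqP => // /(congr1 val) /= e.
  by move: iS; rewrite -e => /n_Sn.
have := ladder_kernel_interior th v iE.
rewrite vi !subr0 add0r [v (inord i.+1)]/v eqxx mulr1.
have -> : \sum_j kernel pi ladder th i j * v j = kernel pi ladder th i (inord i.+1).
  by rewrite -[RHS](sum_delta (kernel pi ladder th i)); apply: eq_bigr => j _; rewrite mulrC.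
move=> ->; rewrite ltr_wpDl ?mulr_gt0 //.
apply: mulr_ge0; first exact: ltW.
by apply: mulr_ge0; [case: ifP => _; rewrite ?ler01 ?ltW|exact: ler0n].
Qed.

(** In an interior state above 1, [odds_step] is the odds of a move up against a reset, and [climb]
    its probability. From state 1, action H has relative weight [eta] against
    [odds_step * climb th ^+ k] for [k.+1] moves up in a row; [win] is the resulting probability of
    H. *)
Definition odds_step th : R := eps * (pi th lo / pi th hi).
Definition climb th : R := odds_step th / (1 + odds_step th).
Definition win th : R := eta / (eta + odds_step th * climb th ^+ k).

(** Above state 1 the play either climbs the remaining [k.+2 - i] rungs or is reset to state 1. *)
Definition ladder_value th (i : 'I_k.+3) : R :=
  if i == 0 :> nat then 1 else if i == 1 :> nat then win th
  else win th * (1 - climb th ^+ (k.+2 - i)).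

Let z_gt0 th : 0 < odds_step th.
Proof. by have [eps0 _] := andP eps01; rewrite mulr_gt0 ?divr_gt0. Qed.

Let den_gt0 th : 0 < eta + odds_step th * climb th ^+ k.
Proof.
have [eta0 _] := andP eta01; have z0 := z_gt0 th.
by rewrite addr_gt0 // mulr_gt0 // exprn_gt0 // divr_gt0 // addr_gt0.
Qed.

Lemma ladder_value_dirichlet th : dirichlet (kernel pi ladder th) ladder_ends
  ladder_action (fun=> 0) (ladder_value th).
Proof.
have z0 := z_gt0 th; have d0 := den_gt0 th.
split=> i.
  rewrite inE /ladder_value /ladder_action -val_eqE /= => /orP[/eqP ->|/eqP ->] //=.
  by rewrite subnn expr0 subrr mulr0.
move=> iE; rewrite addr0 ladder_kernel_interior // -[LHS]addr0; congr (_ + _).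
have [i0 ik] : i != 0 :> nat /\ i != k.+2 :> nat by move: iE; rewrite inE => /norP[].
have ik' : (i < k.+2)%N by rewrite ltn_neqAle ik -ltnS ltn_ord.
have iS : (inord i.+1 : 'I_k.+3) = i.+1 :> nat by rewrite inordK.
have v0 : ladder_value th ord0 = 1 by [].
have v1 : ladder_value th (inord 1) = win th by rewrite /ladder_value inordK.
have vS : ladder_value th (inord i.+1) = win th * (1 - climb th ^+ (k.+1 - i)).
  by rewrite /ladder_value iS /= eqSS (negbTE i0) subSS.
have loE : eps * pi th lo = odds_step th * pi th hi.
  by rewrite /odds_step -!mulrA mulVf ?mulr1 ?gt_eqF.
rewrite vS; have [i1|i1] := eqVneq (i : nat) 1%N.
  rewrite v0 /ladder_value i1 /= subSS subn0.
  have -> : pi th lo * (eps * (win th * (1 - climb th ^+ k) - win th)) =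
     - (eps * pi th lo) * win th * climb th ^+ k by ring.
  by rewrite loE /win; field; rewrite gt_eqF.
rewrite v1 /ladder_value (negbTE i0) (negbTE i1) (@subSn i k.+1 ik') exprS mul1r.
have -> : pi th lo * (eps * (win th * (1 - climb th ^+ (k.+1 - i)) -
    win th * (1 - climb th * climb th ^+ (k.+1 - i)))) =
  (eps * pi th lo) * win th * (climb th * climb th ^+ (k.+1 - i) - climb th ^+ (k.+1 - i)).
  by ring.
rewrite loE; set Y := climb th ^+ _; rewrite /climb; field.
by rewrite gt_eqF // addr_gt0.
Qed.

(** [ladder_value] is superharmonic and majorises the action probability, so by [payoff_le] waiting
    for an end is optimal for both types. *)
Lemma ladder_payoff : receiver_values p pi k.+3
  (p * win true + (1 - p) * (1 - win false)).
Proof.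
have df := ladder_dist.
have dg : is_dist ladder_init := is_dist_delta R (inord 1 : 'I_k.+3).
have sK := kernel_stochastic pi_gt0 pi_sum df.
have a01 i : 0 <= ladder_action i <= 1 by rewrite /ladder_action; case: eqP; rewrite ?lexx ler01.
have start th : average ladder_init (ladder_value th) = win th.
  by rewrite /average sum_delta /ladder_value inordK.
pose never (i : 'I_k.+3) (th : bool) : R := 0.
have vs : valid_strategy never by move=> i th; rewrite lexx ler01.
have stop1 th i : i \in ladder_ends -> stopw ladder never th i = 1.
  rewrite inE /stopw => iE; case: ifP => // /forallP[] s.
  by rewrite /ladder /rate iE mul0r eqxx subr0 mulr1 add0r.
have stop0 th i : i \notin ladder_ends -> stopw ladder never th i = 0.
  move=> iE; rewrite /stopw; case: ifP => // /(absorbing_in df (@ladder_hits th)).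
  by rewrite (negbTE iE).
have pay th b h := payoff_dirichlet pi_gt0 pi_sum df dg vs (@ladder_hits th)
  (stop1 th) (stop0 th) (b := b) (h := h).
have v01 th := dirichlet01 (sK th) (@ladder_hits th) (ladder_value_dirichlet th) a01.
exists ladder, ladder_init, ladder_action, never; split; [|split].
- by split=> //; split.
- split=> // sigma' vs'.
  rewrite /US !big_bool /= !(pay _ _ _ (ladder_value_dirichlet _)).
  have le th : \sum_i endprob pi ladder ladder_init sigma' th i * ladder_action i <=
      average ladder_init (ladder_value th).
    apply: payoff_le => // i; first by have /andP[] := v01 th i.
      have [iE|iE] := boolP (i \in ladder_ends).
        by rewrite (ladder_value_dirichlet th).1.
      rewrite /ladder_action -val_eqE /=; case: eqP => [i0|_].
        by move: iE; rewrite inE i0.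
      by have /andP[] := v01 th i.
    have [iE|iE] := boolP (i \in ladder_ends).
      rewrite ladder_kernel_avg big1 ?addr0 // => s _.
      by move: iE; rewrite inE /rate => ->; rewrite mul0r mulr0.
    by rewrite [leRHS](ladder_value_dirichlet th).2 // addr0.
  move: p01 => /andP[p0 p1].
  by apply: lerD; apply: ler_wpM2l => //; rewrite ?subr_ge0 ltW.
- rewrite /UR big_bool /= (pay _ _ _ (ladder_value_dirichlet _)) start.
  rewrite (pay _ _ _ (dirichlet_compl (sK _) (ladder_value_dirichlet _))).
  congr (_ + _ * _); rewrite -(start false) /average.
  by under [RHS]eq_bigr do rewrite mulrBr mulr1; rewrite sumrB dg.2.
Qed.

End Ladder.

(** * Ladder values as [eps] tends to 0 *)

Lemma exp1D_le (R : realType) (e : R) n : 0 <= e <= 1 ->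
  (1 + e) ^+ n <= 1 + 3 ^+ n * e.
Proof.
move=> /andP[e0 e1]; elim: n => [|n IH]; first by rewrite !expr0 mul1r lerDl.
have t1 : 1 <= 3 ^+ n :> R by rewrite exprn_ege1 // ler1n.
rewrite !exprS; apply: (@le_trans _ _ ((1 + e) * (1 + 3 ^+ n * e))).
  by rewrite ler_wpM2l // addr_ge0.
have : 0 <= 3 ^+ n * e * (1 - e) by rewrite !mulr_ge0 ?subr_ge0 // (le_trans ler01).
have : 0 <= (3 ^+ n - 1) * e by rewrite mulr_ge0 ?subr_ge0.
by lra.
Qed.

Section LadderLimit.
Variables (R : realType) (S : finType) (p : R) (pi : bool -> S -> R) (k : nat).
Hypothesis p01 : 0 < p < 1.
Hypothesis pi_gt0 : forall th s, 0 < pi th s.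
Hypothesis pi_sum : forall th, \sum_(s : S) pi th s = 1.

(* For a target odds ratio [C] of losing against winning in state [H], [eta] is
   tuned so that the odds are [C] and [C * gamma ^+ k.+1] up to factors that tend
   to 1 as [eps] tends to 0. *)
Lemma ladder_values_near (C d : R) : 0 < C -> 0 < d -> 1 < gamma pi ->
  exists2 u, receiver_values p pi k.+3 u &
  p / (1 + C) + (1 - p) * (1 - 1 / (1 + C * gamma pi ^+ k.+1)) - d <= u.
Proof.
move=> C0 d0 g1; have [p0 p1] := andP p01.
have [hi [lo [lbarE lunderE hiP loP]]] := extreme_signals pi_gt0 pi_sum.
have hilo : hi != lo.
  apply: contraTneq g1 => e.
  by rewrite /gamma lbarE lunderE e divff ?ltxx // gt_eqF // lratio_gt0.
pose rho th := pi th lo / pi th hi.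
have rho0 th : 0 < rho th by rewrite divr_gt0.
have rhoE : rho false = gamma pi * rho true.
  by rewrite /rho /gamma lbarE lunderE /lratio; field; rewrite !gt_eqF.
pose Q : R := 3 ^+ k.
have Q0 : 0 < Q by rewrite exprn_gt0.
(* The sum of all lower bounds on [1 / eps]: they give [eps <= 1], [z th <= 1], an error of at most
   [d], and [eta <= 1]. *)
pose M := 1 + rho true + rho false + rho false * Q / d + rho true / C.
have M1 : [/\ 1 <= M, rho true <= M, rho false <= M, rho false * Q / d <= M & rho true / C <= M].
  have a := rho0 true; have b := rho0 false.
  have c : 0 < rho false * Q / d by rewrite divr_gt0 // mulr_gt0.
  have e : 0 < rho true / C by rewrite divr_gt0.
  by rewrite /M; split; lra.
have [M1a M1b M1c M1d M1e] := M1.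
have M0 : 0 < M by apply: lt_le_trans M1a.
pose eps := M^-1.
have eps0 : 0 < eps by rewrite invr_gt0.
have epsM x : x <= M -> eps * x <= 1 by rewrite mulrC ler_pdivrMr // mul1r.
have eps1 : eps <= 1 by have := epsM 1 M1a; rewrite mulr1.
pose z th := eps * rho th.
have z0 th : 0 < z th by rewrite mulr_gt0.
have zH1 : z true <= 1 by exact: epsM.
have zL1 : z false <= 1 by exact: epsM.
have zLd : Q * z false <= d.
  by have := epsM _ M1d; rewrite mulrA ler_pdivrMr // mul1r /z; lra.
have zHC : z true <= C by have := epsM _ M1e; rewrite mulrA ler_pdivrMr // mul1r.
pose eta := z true ^+ k.+1 / C.
have eta0 : 0 < eta by rewrite divr_gt0 // exprn_gt0.
have etaC : C * eta = z true ^+ k.+1 by rewrite mulrC divfK // gt_eqF.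
have eta1 : eta <= 1.
  rewrite ler_pdivrMr // mul1r; apply: le_trans zHC.
  by rewrite exprS ler_piMr ?exprn_ile1 // ltW.
have eps01 : 0 < eps <= 1 by rewrite eps0.
have eta01 : 0 < eta <= 1 by rewrite eta0.
have u_in := ladder_payoff k p01 pi_gt0 pi_sum hilo eps01 eta01.
set G := gamma pi ^+ k.+1.
have G0 : 0 < G by rewrite exprn_gt0 // (lt_trans ltr01).
have CG : 0 < C * G by rewrite mulr_gt0.
pose y th := z th / (1 + z th).
have z10 th : 0 < 1 + z th by rewrite addr_gt0.
have y0 th : 0 < y th by rewrite divr_gt0.
have winE th : win pi k hi lo eps eta th = eta / (eta + z th * y th ^+ k) by [].
have den0 th : 0 < eta + z th * y th ^+ k by rewrite addr_gt0 // mulr_gt0 // exprn_gt0.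
(* As [y true <= z true], the denominator is at most [eta + z true ^+ k.+1], that is
   [(1 + C) * eta]. *)
have winH : 1 / (1 + C) <= win pi k hi lo eps eta true.
  rewrite winE ler_pdivrMr ?addr_gt0 // mulrAC ler_pdivlMr // mul1r mulrDr mulr1 lerD2l.
  apply: (@le_trans _ _ (z true * z true ^+ k)); last by rewrite -exprS -etaC mulrC.
  rewrite ler_wpM2l ?(ltW (z0 _)) //.
  apply: lerXn2r; rewrite ?nnegrE ?(ltW (y0 _)) ?(ltW (z0 _)) //.
  by rewrite ler_pdivrMr // ler_peMr ?(ltW (z0 _)) // lerDl ltW.
(* For type L, [W] makes up for the difference between [y] and [z], since
   [(1 + z false) * y false = z false]. *)
pose W := (1 + z false) ^+ k.
have W1 : 1 <= W by rewrite exprn_ege1 // lerDl ltW.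
have WE : W * (z false * y false ^+ k) = C * G * eta.
  have zE : z false = gamma pi * z true by rewrite /z rhoE mulrCA.
  have yE : (1 + z false) * y false = z false by rewrite mulrC divfK ?gt_eqF.
  have -> : W * (z false * y false ^+ k) = z false * ((1 + z false) * y false) ^+ k.
    by rewrite [in RHS]exprMn /W; ring.
  have -> : C * G * eta = G * (C * eta) by ring.
  by rewrite yE -exprS etaC -exprMn -zE.
have winL : win pi k hi lo eps eta false <= W / (1 + C * G).
  rewrite winE ler_pdivrMr // mulrAC ler_pdivlMr ?addr_gt0 //.
  rewrite mulrDr mulr1 mulrDr WE [C * G * eta]mulrC lerD2r.
  by rewrite ler_peMl // ltW.
exists (p * win pi k hi lo eps eta true + (1 - p) * (1 - win pi k hi lo eps eta false)) => //.
have Wd : W - 1 <= d.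
  have := @exp1D_le _ (z false) k; rewrite (ltW (z0 _)) zL1 => /(_ isT).
  by rewrite -/W -/Q; lra.
have inv1 : (1 + C * G)^-1 <= 1 by rewrite invf_le1 ?addr_gt0 // lerDl ltW.
have inv0 : 0 < (1 + C * G)^-1 by rewrite invr_gt0 addr_gt0.
have WGle : W / (1 + C * G) <= 1 / (1 + C * G) + d.
  have : (W - 1) / (1 + C * G) <= W - 1 by rewrite ler_piMr // subr_ge0.
  by lra.
have L1 : p * (1 / (1 + C)) <= p * win pi k hi lo eps eta true by rewrite ler_wpM2l // ltW.
have q0 : 0 < 1 - p by rewrite subr_gt0.
have L2 : (1 - p) * (1 - 1 / (1 + C * G) - d) <=
    (1 - p) * (1 - win pi k hi lo eps eta false) by rewrite ler_wpM2l ?(ltW q0) //; lra.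
have : 0 <= p * d by rewrite mulr_ge0 // ltW.
by move: L1 L2; lra.
Qed.

End LadderLimit.

(** * The optimal payoff and its non-attainment *)

Theorem theorem2 (R : realType) (S : finType) (p : R) (pi : bool -> S -> R)
    (m : nat) :
  (2 <= m)%N ->
  0 < p < 1 ->
  (forall th s, 0 < pi th s) ->
  (forall th, \sum_(s : S) pi th s = 1) ->
  pi true <> pi false ->
  optimal_receiver_payoff p pi m =
    (if kappa p < gamma pi ^+ (m - 2) then
       1 - (2 * Num.sqrt (p * (1 - p) * gamma pi ^+ (m - 2)) - 1)
             / (gamma pi ^+ (m - 2) - 1)
     else Num.max p (1 - p))
  /\
  ((4 <= m)%N -> kappa p < gamma pi ^+ (m - 2) ->
   ~ exists (f : 'I_m -> S -> 'I_m -> R) g a sigma,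
       valid_protocol f g a /\ best_response p pi f g a sigma /\
       UR p pi f g a sigma = optimal_receiver_payoff p pi m).
Proof.
move=> m2 p01 pi_gt0 pi_sum _.
have [p0 p1] := andP p01.
have G1 : 1 <= gamma pi ^+ (m - 2) by rewrite exprn_ege1 // gamma_ge1.
set G := gamma pi ^+ (m - 2) in G1 *.
have m0 : (0 < m)%N by apply: leq_trans m2.
(* These values also make the set nonempty, as needed to bound its [sup]. *)
have [c0 c1] : receiver_values p pi m p /\ receiver_values p pi m (1 - p).
  split.
    have := @constant_action_value R S p pi m pi_gt0 pi_sum 1 m0.
    by rewrite subrr mulr0 addr0 mulr1; apply; rewrite ler01 lexx.
  have := @constant_action_value R S p pi m pi_gt0 pi_sum 0 m0.
  by rewrite mulr0 add0r subr0 mulr1; apply; rewrite ler01 lexx.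
have opt : optimal_receiver_payoff p pi m =
    if kappa p < G then 1 - (2 * Num.sqrt (p * (1 - p) * G) - 1) / (G - 1)
    else Num.max p (1 - p).
  rewrite /optimal_receiver_payoff; case: ifPn => [kG|]; last first.
    rewrite -leNgt => kG.
    have ub : ubound (receiver_values p pi m) (Num.max p (1 - p)).
      move=> _ [f [g [a [sigma [vp [br ->]]]]]].
      have [X [Y [[X01 Y01] odds le _]]] := receiver_payoff_bound p01 pi_gt0 pi_sum vp br.
      apply: le_trans le _; apply: receiver_bound_uninformative odds => //.
      by rewrite G1.
    apply/eqP; rewrite eq_le; apply/andP; split; first by apply: ge_sup => //; exists p.
    by rewrite ge_max !ub_le_sup //; exists (Num.max p (1 - p)).
  set v := 1 - _.
  have ub : ubound (receiver_values p pi m) v.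
    move=> _ [f [g [a [sigma [vp [br ->]]]]]].
    have [X [Y [[X01 Y01] odds le _]]] := receiver_payoff_bound p01 pi_gt0 pi_sum vp br.
    apply: le_trans le _.
    by have [] := receiver_bound_informative p01 kG X01 Y01 odds.
  apply/eqP; rewrite eq_le; apply/andP; split; first by apply: ge_sup => //; exists p.
  have g1 : 1 < G by apply: le_lt_trans kG; exact: kappa_ge1.
  have gm1 : 1 < gamma pi.
    rewrite ltNge; apply: contraL g1 => gle; rewrite -leNgt.
    by rewrite exprn_ile1 // (le_trans ler01) // gamma_ge1.
  (* For [m = 2] the exponent is 0 and [G = 1], against [g1]; so [m = k.+3]. *)
  case: m m2 @G G1 m0 c0 c1 kG @v ub g1 gm1 => [|[|[|k]]] // _ G G1 _ c0 _ kG v ub g1 gm1.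
    by move: g1; rewrite /G subnn expr0 ltxx.
  have GE : G = gamma pi ^+ k.+1 by rewrite /G !subSS subn0.
  move: kG; rewrite kappa_lt // => /andP[k1 k2].
  have G0 : 0 < G by apply: lt_trans g1.
  have q0 : 0 < 1 - p by rewrite subr_gt0.
  have gm0 : 0 < G - 1 by rewrite subr_gt0.
  pose r := Num.sqrt (p * (1 - p) * G).
  have r2 : r * r = p * (1 - p) * G.
    by rewrite -expr2 sqr_sqrtr // !mulr_ge0 // ltW.
  have r0 : 0 < r by rewrite sqrtr_gt0 !mulr_gt0.
  have sqlt (x y : R) : 0 <= x -> 0 <= y -> x * x < y * y -> x < y.
    by move=> x0 y0; rewrite -!expr2 ltr_pXn2r.
  (* The hypothesis [kappa p < G] amounts to [p < r < p * G], which makes [C] positive. *)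
  have pr : p < r.
    by apply: sqlt; [exact: ltW|exact: ltW|]; rewrite r2 -mulrA ltr_pM2l // mulrC.
  have rG : r < p * G.
    apply: sqlt; [exact: ltW|by rewrite mulr_ge0 // ltW|].
    have -> : r * r = (p * G) * (1 - p) by rewrite r2; ring.
    by rewrite ltr_pM2l ?mulr_gt0 // mulrC.
  have pGr : 0 < p * G - r by rewrite subr_gt0.
  pose C := (r - p) / (p * G - r).
  have C0 : 0 < C by rewrite divr_gt0 // subr_gt0.
  (* [C] minimises the receiver's error [p * C / (1 + C) + (1 - p) / (1 + C * G)]. *)
  have vE : v = p / (1 + C) + (1 - p) * (1 - 1 / (1 + C * G)).
    have C1 : 1 + C = p * (G - 1) / (p * G - r) by rewrite /C; field; rewrite gt_eqF.
    have CG1 : 1 + C * G = r * (G - 1) / (p * G - r) by rewrite /C; field; rewrite gt_eqF.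
    have G10 : G - 1 != 0 by rewrite gt_eqF.
    have pGr0 : p * G - r != 0 by rewrite gt_eqF.
    have pC : p / (1 + C) = (p * G - r) / (G - 1).
      by rewrite C1; field; rewrite G10 pGr0 gt_eqF.
    have qC : (1 - p) * (1 / (1 + C * G)) = (r - (1 - p)) / (G - 1).
      have E : (1 - p) * (p * G - r) = r * (r - (1 - p)) by rewrite [RHS]mulrBr r2; ring.
      have -> : (1 - p) * (1 / (1 + C * G)) = (1 - p) * (p * G - r) / (r * (G - 1)).
        by rewrite CG1; field; rewrite G10 pGr0 gt_eqF.
      by rewrite E; field; rewrite G10 gt_eqF.
    by rewrite mulrBr mulr1 pC qC /v -/r; field.
  apply/ler_addgt0Pl => d d0.
  have [u uin ule] := @ladder_values_near R S p pi k p01 pi_gt0 pi_sum C d C0 d0 gm1.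
  rewrite -GE -vE in ule.
  have : u <= sup (receiver_values p pi k.+3) by apply: ub_le_sup => //; exists v.
  by lra.
split=> // m4 kG [f [g [a [sigma [vp [br]]]]]]; rewrite opt kG => E.
(* Attaining the supremum means equality in the AM-GM bound, hence interior [X] and [Y] with the
   odds bound attained, which [strict] excludes. *)
have [X [Y [[X01 Y01] odds le strict]]] := receiver_payoff_bound p01 pi_gt0 pi_sum vp br.
have [le' eq] := receiver_bound_informative p01 kG X01 Y01 odds.
have [|X0 Y0 E'] := eq; first by apply/eqP; rewrite eq_le le' -E le.
apply: strict E' => //.
have g1 : 1 < G by apply: le_lt_trans kG; exact: kappa_ge1.
rewrite ltNge; apply: contraL g1 => gle; rewrite -leNgt.
by rewrite exprn_ile1 // (le_trans ler01) // gamma_ge1.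
Qed.
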